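(* Let $\mathsf{N},\mathsf{T},\mathsf{M}$ be positive integers with $\mathsf{N}=\mathsf{T}+1$ and $\mathsf{N}<\mathsf{M}$, and let $\eta>0$. For any $\epsilon>0$ and $\xi>0$ there exists a coding scheme $\mathcal{C}(\mathsf{N},\mathsf{T},\mathsf{M},\eta)$ that satisfies $\mathsf{T}$-node $\epsilon$-DP and has $$\mathtt{LMSE}(\mathcal{C})\le\eta^{\mathsf{M}}\,\frac{(1+\mathtt{SNR}^*(\epsilon))^{\mathsf{M}}-\mathsf{M}\,\mathtt{SNR}^*(\epsilon)^{\mathsf{M}-1}-\mathtt{SNR}^*(\epsilon)^{\mathsf{M}}}{(1+\mathtt{SNR}^*(\epsilon))^{\mathsf{M}}}+\xi.$$
   Context: Setting (distributed secure multiplication). There are $\mathsf{N}$ nodes and $\mathsf{M}$ real-valued inputs $A_1,\dots,A_{\mathsf{M}}$, which are mutually independent, have zero mean, and satisfy $\mathrm{Var}(A_i)\le\eta$. A coding scheme $\mathcal{C}(\mathsf{N},\mathsf{T},\mathsf{M},\eta)$ consists of (i) a joint distribution of real zero-mean noise variables $\{\tilde R_i^{(j)}\}_{i\in[\mathsf{M}],j\in[\mathsf{N}]}$, independent of the inputs, such that the families $\{\tilde R_1^{(j)}\}_{j},\dots,\{\tilde R_{\mathsf{M}}^{(j)}\}_{j}$ are mutually independent; and (ii) real decoding coefficients $d_1,\dots,d_{\mathsf{N}}$ (which may be chosen knowing the noise distribution and $\mathsf{N},\mathsf{T},\mathsf{M},\eta$). Node $j$ stores $\tilde A_i^{(j)}=A_i+\tilde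 R_i^{(j)}$ for $i\in[\mathsf{M}]$ and outputs $\tilde V^{(j)}=\prod_{i=1}^{\mathsf{M}}(A_i+\tilde R_i^{(j)})$; the decoder outputs $\tilde V=\sum_{j=1}^{\mathsf{N}} d_j\tilde V^{(j)}$. $\mathsf{T}$-node $\epsilon$-DP: for each $i\in[\mathsf{M}]$, all $a_0,a_1\in\mathbb{R}$ with $|a_0-a_1|\le1$, every $\mathcal{T}=\{t_1,\dots,t_{\mathsf{T}}\}\subseteq[\mathsf{N}]$ with $|\mathcal{T}|=\mathsf{T}$ and every Borel set $\mathcal{B}\subseteq\mathbb{R}^{\mathsf{T}}$, $\mathbb{P}\big((a_0+\tilde R_i^{(t_1)},\dots,a_0+\tilde R_i^{(t_{\mathsf{T}})})\in\mathcal{B}\big)\le e^{\epsilon}\,\mathbb{P}\big((a_1+\tilde R_i^{(t_1)},\dots,a_1+\tilde R_i^{(t_{\mathsf{T}})})\in\mathcal{B}\big)$. $\mathtt{LMSE}(\mathcal{C})=\sup \mathbb{E}\big[|\tilde V-\prod_{i=1}^{\mathsf{M}}A_i|^2\big]$, the supremum over all joint laws of $(A_1,\dots,A_{\mathsf{M}})$ with mutually independent zero-mean components of variance at most $\eta$; expectation over inputs and noise. Notation: $\mathtt{SNR}^*(\epsilon)=\eta/\sigma^*(\epsilon)^2$, where $\sigma^*(\epsilon)^2=\dfrac{2^{2/3}e^{-2\epsilon/3}(1+e^{-2\epsilon/3})+e^{-\epsilon}}{(1-e^{-\epsilon})^2}$. *)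

(* Defs.v *)
From HB Require Import structures.
From mathcomp Require Import all_boot all_order all_algebra.
From mathcomp Require Import all_classical all_reals all_analysis.

Set Implicit Arguments.
Unset Strict Implicit.
Unset Printing Implicit Defensive.

Import Order.TTheory GRing.Theory Num.Theory.
Local Open Scope classical_set_scope.
Local Open Scope ring_scope.

Definition sigma_star_sq {R : realType} (eps : R) : R :=
  ((2 : R) `^ (2 / 3) * expR (- (2 * eps / 3)) * (1 + expR (- (2 * eps / 3)))
     + expR (- eps)) / (1 - expR (- eps)) ^+ 2.

Definition SNR_star {R : realType} (eta eps : R) : R := eta / sigma_star_sq eps.

Definition gen_sigma {d} {Om : measurableType d} {R : realType} {J : finType}
  (X : J -> Om -> R) : set (set Om) :=
  <<s [set E | exists (j : J) (B : set R), measurable B /\ E = X j @^-1` B] >>.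

Definition indep_families {d} {Om : measurableType d} {R : realType}
  (P : probability Om R) {I J : finType} (X : I -> J -> Om -> R) : Prop :=
  forall E : I -> set Om, (forall i, gen_sigma (X i) (E i)) ->
    P (\bigcap_i E i) = (\prod_(i : I) P (E i))%E.

Definition mutually_indep {d} {Om : measurableType d} {R : realType}
  (P : probability Om R) {I : finType} (X : I -> Om -> R) : Prop :=
  indep_families P (fun i (_ : unit) => X i).

Definition zero_mean {d} {Om : measurableType d} {R : realType}
  (P : probability Om R) (X : Om -> R) : Prop :=
  P.-integrable setT (EFin \o X) /\ (\int[P]_w (X w)%:E = 0)%E.

(* T-node eps-DP of the noise Rn (indices i in [M], j in [N]).  A subset
   {t_1,...,t_T} of [N] of size T is given by an injective t : 'I_T -> 'I_N;
   R^T carries its (Borel = product) sigma-algebra via T.-tuple R. *)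
Definition node_DP {d} {Om : measurableType d} {R : realType}
  (P : probability Om R) (N T M : nat) (Rn : 'I_M -> 'I_N -> Om -> R)
  (eps : R) : Prop :=
  forall (i : 'I_M) (a0 a1 : R), `|a0 - a1| <= 1 ->
  forall t : 'I_T -> 'I_N, injective t ->
  forall B : set (T.-tuple R), measurable B ->
    (P [set w | B [tuple (a0 + Rn i (t k) w)%R | k < T]]
     <= (expR eps)%:E * P [set w | B [tuple (a1 + Rn i (t k) w)%R | k < T]])%E.

Definition coding_scheme {d} {Om : measurableType d} {R : realType}
  (P : probability Om R) (N M : nat) (Rn : 'I_M -> 'I_N -> Om -> R) : Prop :=
  (forall i j, measurable_fun setT (Rn i j)) /\
  (forall i j, zero_mean P (Rn i j)) /\
  indep_families P Rn.

(* LMSE: supremum, over all laws of inputs (A_1..A_M) (on any probability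
   space (OmA,Q)) with mutually independent zero-mean components of
   variance <= eta, of E|V~ - prod A_i|^2, the expectation being taken
   under the product measure Q \x P (inputs independent of the noise). *)
Definition LMSE {d} {Om : measurableType d} {R : realType}
  (P : probability Om R) (N M : nat) (eta : R)
  (Rn : 'I_M -> 'I_N -> Om -> R) (dec : 'I_N -> R) : \bar R :=
  ereal_sup [set v : \bar R | exists (dA : measure_display)
      (OmA : measurableType dA) (Q : probability OmA R) (A : 'I_M -> OmA -> R),
      [/\ (forall i, measurable_fun setT (A i)),
          mutually_indep Q A,
          (forall i, zero_mean Q (A i)),
          (forall i, (\int[Q]_x ((A i x) ^+ 2)%:E <= eta%:E)%E) &
          v = (\int[Q \x P]_z
                 ((\sum_(j < N) dec j * \prod_(i < M) (A i z.1 + Rn i j z.2)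
                   - \prod_(i < M) A i z.1) ^+ 2)%:E)%E]].

(* Main.v *)
Require Import Defs.
From HB Require Import structures.
From mathcomp Require Import all_boot all_order all_algebra.
From mathcomp Require Import all_classical all_reals all_analysis.
From mathcomp Require Import measurable_realfun ring lra zify.
Set Implicit Arguments.
Unset Strict Implicit.
Unset Printing Implicit Defensive.
Import Order.TTheory GRing.Theory Num.Theory.
Import numFieldNormedType.Exports.
Local Open Scope classical_set_scope.
Local Open Scope ring_scope.

(** Write b = exp(-eps) and t = exp(-eps/3).  The staircase law with density
    proportional to the sum over k of b^k times the indicator of [-(k+g), k+g]
    is eps-private, because shifting one interval by at most 1 keeps it inside
    the next one.  For g = (t - t^3)/(1 - t^3) its variance is at most
    (t^2 + t^3)/(1 - t^3)^2, which is strictly below sigma*(eps)^2; hence some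
    eps' < eps still has variance at most sigma*(eps)^2, and the law can be
    scaled up to have exactly this variance, leaving a privacy budget eps - eps'.

    For each input draw R from this law and T - 1 masking noises Z_l spending the
    remaining budget.  Node 0 gets R and node j > 0 gets (1 + del) R + del Z_j,
    with Z_T := - sum Z_l.  Any T nodes see an invertible image of (R, Z), and
    adding a constant to the input amounts to a bounded shift of (R, Z) in which
    R moves by at most that constant.

    Decoding with weights al - be/del on node 0 and be/(del T) on the others
    cancels the masks to first order; as del -> 0 the decoder computes
    al V + be V', where V = prod (A_i + R_i) and V' is its derivative along R.
    Since the families are independent, the error is the quadratic form
    sum_{j,j'} d_j d_j' prod_i (E A_i^2 + Cov_{jj'}), which is nondecreasing in
    E A_i^2 because Cov is a Gram matrix.  In the limit it is the residual of the
    regression of 1_{K=0} on affine functions of a binomial variable K, whose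
    minimum is the stated value. *)

(** * Expectation of products of independent variables *)

Section indep_expectation.
Context d (T : measurableType d) (R : realType) (P : probability T R).

Lemma measurable_preimageT (f : T -> R) (B : set R) :
  measurable_fun setT f -> measurable B -> measurable (f @^-1` B).
Proof. by move=> mf mB; rewrite -[X in measurable X]setTI; exact: mf. Qed.

Lemma integral_indic_preimage (f : T -> R) (B : set R) :
  measurable_fun setT f -> measurable B ->
  (\int[P]_x (\1_B (f x))%:E = P (f @^-1` B))%E.
Proof.
move=> mf mB; rewrite (eq_integral (fun x => (\1_(f @^-1` B) x)%:E))//.
by rewrite integral_indic//= ?setIT//; exact: measurable_preimageT.
Qed.

Lemma measurable_layer (f : T -> R) (g : T -> \bar R) :
  measurable_fun setT f -> measurable_fun setT g ->
  measurable_fun setT (fun p : T * measurableTypeR R =>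
    ((\1_(`[0%R, f p.1[) p.2)%:E * g p.1)%E).
Proof.
move=> mf mg; apply: emeasurable_funM; last exact: measurableT_comp.
apply/measurable_EFinP/measurable_indic => /=.
pose fsnd (p : T * measurableTypeR R) := (0 <= p.2)%R.
pose f21 (p : T * measurableTypeR R) := (p.2 < f p.1)%R.
rewrite [X in measurable X](_ : _ =
    fsnd @^-1` [set true] `&` f21 @^-1` [set true]); last first.
  by apply/seteqP; split => p; rewrite in_itv/= => /andP.
apply: measurableI.
- have : measurable_fun setT fsnd by exact: measurable_fun_ler.
  by move=> /(_ measurableT [set true]); rewrite setTI; exact.
- have : measurable_fun setT f21.
    by apply: measurable_fun_ltr => //; exact: measurableT_comp.
  by move=> /(_ measurableT [set true]); rewrite setTI; exact.
Qed.

(** The number [f x] is the length of [[0, f x[], so the factor [f x] becomes an integral over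
    levels [t], and Tonelli exchanges the two integrals. *)
Lemma ge0_integral_layer_cake (f : T -> R) (g : T -> \bar R) :
  measurable_fun setT f -> (forall x, 0 <= f x) ->
  measurable_fun setT g -> (forall x, 0 <= g x)%E ->
  (\int[P]_x ((f x)%:E * g x) =
   \int[lebesgue_measure]_t \int[P]_x ((\1_(`[0%R, f x[) t)%:E * g x))%E.
Proof.
move=> mf f0 mg g0.
transitivity
    (\int[P]_x \int[lebesgue_measure]_t ((\1_(`[0%R, f x[) t)%:E * g x))%E.
  apply: eq_integral => x _.
  rewrite ge0_integralZr//.
    rewrite integral_indic//= setIT lebesgue_measure_itv/= lte_fin.
    have := f0 x; rewrite le_eqVlt => /orP[/eqP <-|->]; first by rewrite ltxx.
    by rewrite sube0.
  exact/measurable_EFinP.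
rewrite (fubini_tonelli (fun p : T * measurableTypeR R =>
  ((\1_(`[0%R, f p.1[) p.2)%:E * g p.1)%E))//=; first exact: measurable_layer.
by move=> p; rewrite mule_ge0// lee_fin.
Qed.

(** After slicing [f] into layers, the level [t] contributes the indicator of [f x > t], so the
    hypothesis is applied with [B] the ray above [t]. *)
Lemma ge0_integralM_indep (f : T -> R) (g : T -> \bar R) :
  measurable_fun setT f -> (forall x, 0 <= f x) ->
  measurable_fun setT g -> (forall x, 0 <= g x)%E ->
  (forall B : set R, measurable B ->
    \int[P]_x ((\1_B (f x))%:E * g x) = P (f @^-1` B) * \int[P]_x g x)%E ->
  (\int[P]_x ((f x)%:E * g x) = \int[P]_x (f x)%:E * \int[P]_x g x)%E.
Proof.
move=> mf f0 mg g0 H.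
have E x : ((f x)%:E = (f x)%:E * cst 1 x)%E by rewrite /cst mule1.
under [in RHS]eq_integral do rewrite E.
rewrite !ge0_integral_layer_cake//.
rewrite -ge0_integralZr//; last 3 first.
- have := @measurable_fun_fubini_tonelli_G _ _ T (measurableTypeR R) R P
     (fun p => ((\1_(`[0%R, f p.1[) p.2)%:E * cst 1%E p.1)%E).
  by apply; [exact: measurable_layer|move=> p; rewrite mule_ge0// lee_fin].
- by move=> t _; apply: integral_ge0 => x _; rewrite mule_ge0// lee_fin.
- exact: integral_ge0.
apply: eq_integral => t _.
(* No interval [[0, f x[] contains a negative level, so both sides vanish there. *)
have [t0|t0] := leP 0 t; last first.
  have n0 x : (\1_(`[0%R, f x[) t = 0 :> R).
    by rewrite indicE memNset//= in_itv/= leNgt t0.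
  rewrite [LHS]integral0_eq; last by move=> x _; rewrite n0 mul0e.
  by rewrite [X in (_ = X * _)%E]integral0_eq ?mul0e// => x _; rewrite n0 mul0e.
have F x : (\1_(`[0%R, f x[) t = \1_(`]t, +oo[%classic) (f x) :> R).
  rewrite !indicE; congr (_%:R); apply: congr1.
  by apply/idP/idP; rewrite !inE/= !in_itv/= t0 andbT.
under eq_integral do rewrite F.
under [in RHS]eq_integral do rewrite F /cst mule1.
by rewrite H// integral_indic_preimage.
Qed.

(** Subfamilies are covered by taking [B i = setT] at the other indices. *)
Definition indep_rv (I : finType) (f : I -> T -> R) :=
  forall B : I -> set R, (forall i, measurable (B i)) ->
  P (\bigcap_i (f i @^-1` B i)) = (\prod_i P (f i @^-1` B i))%E.

Lemma indep_rv_comp (I : finType) (f : I -> T -> R) (h : I -> R -> R) :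
  (forall i, measurable_fun setT (h i)) -> indep_rv f ->
  indep_rv (fun i => h i \o f i).
Proof.
move=> mh indf B mB; apply: (indf (fun i => h i @^-1` B i)) => i.
by rewrite -[X in measurable X]setTI; exact: mh.
Qed.

Lemma prode_EFin (I : Type) (r : seq I) (Q : pred I) (F : I -> R) :
  (\prod_(i <- r | Q i) (F i)%:E = (\prod_(i <- r | Q i) F i)%:E)%E.
Proof. by elim/big_rec2 : _ => // i x y _ ->; rewrite EFinM. Qed.

(* Indicators are replaced by the functions one index at a time. *)
Lemma ge0_integral_prod_indep (I : finType) (f : I -> T -> R) :
  (forall i, measurable_fun setT (f i)) -> (forall i x, 0 <= f i x) ->
  indep_rv f ->
  (\int[P]_x (\prod_i f i x)%:E = \prod_i \int[P]_x (f i x)%:E)%E.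
Proof.
move=> mf f0 indf.
pose g (s : seq I) (B : I -> set R) i x :=
  if i \in s then f i x else \1_(B i) (f i x).
suff H (s : seq I) : uniq s -> forall B, (forall i, measurable (B i)) ->
    (\int[P]_x (\prod_i g s B i x)%:E = \prod_i \int[P]_x (g s B i x)%:E)%E.
  have := H (enum I) (enum_uniq _) (fun=> setT) (fun=> measurableT).
  rewrite /g; under eq_integral do under eq_bigr do rewrite mem_enum inE.
  by under [X in _ = X -> _]eq_bigr do under eq_integral do rewrite mem_enum inE.
elim: s => [_ B mB|i s IH /= /andP[nis us] B mB].
  have E x : \prod_i g [::] B i x = \1_(\bigcap_i (f i @^-1` B i)) x.
    rewrite /g [RHS]indicE; case: (boolP (x \in _)) => [|/negP]; rewrite inE.
      move=> xB; rewrite big1// => i _; rewrite indicE mem_set//.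
      exact: xB.
    move=> /existsNP[i /not_implyP[_ xB]].
    by rewrite (bigD1 i)//= indicE memNset// mul0r.
  under eq_integral do rewrite E.
  rewrite integral_indic//= ?setIT//; last first.
    apply: fin_bigcap_measurable => // i _; exact: measurable_preimageT.
  rewrite indf//; apply: eq_bigr => i _; rewrite /g/=.
  by rewrite integral_indic_preimage.
have mg s' B' j : (forall i, measurable (B' i)) -> measurable_fun setT (g s' B' j).
  move=> mB'; rewrite /g; case: (j \in s') => //.
  by apply: (@measurableT_comp _ _ _ _ _ _ (\1_(B' j) : R -> R) _ (f j)) => //;
    exact: measurable_indic.
have g0 s' B' j x : 0 <= g s' B' j x by rewrite /g; case: ifP.
pose G x := (\prod_(j | j != i) g s B j x)%:E.
have G0 x : (0 <= G x)%E by rewrite lee_fin prodr_ge0.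
have mG : measurable_fun setT G.
  apply/measurable_EFinP; under eq_fun do rewrite -big_filter.
  by apply: measurable_prod => j _; exact: mg.
have gs j x : j != i -> g (i :: s) B j x = g s B j x.
  by move=> ji; rewrite /g in_cons (negbTE ji).
(* The induction hypothesis, with an arbitrary set placed at index [i], says that indicators of
   [f i] factor out of the remaining product; this is what [ge0_integralM_indep] asks for. *)
have K (B' : set R) : measurable B' ->
    (\int[P]_x ((\1_B' (f i x))%:E * G x) =
     P (f i @^-1` B') * \prod_(j | j != i) \int[P]_x (g s B j x)%:E)%E.
  move=> mB'; pose BB j := if j == i then B' else B j.
  have mBB j : measurable (BB j) by rewrite /BB; case: eqP.
  have gE j x : j != i -> g s BB j x = g s B j x.
    by move=> ji; rewrite /g /BB (negbTE ji).
  have gi x : g s BB i x = \1_B' (f i x) by rewrite /g /BB eqxx (negbTE nis).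
  have := IH us BB mBB; rewrite [in RHS](bigD1 i)//=.
  under eq_integral do rewrite (bigD1 i)//= EFinM gi.
  under eq_integral do under eq_bigr do rewrite gE//.
  move=> ->; congr (_ * _)%E.
    by under eq_integral do rewrite gi; rewrite integral_indic_preimage.
  by apply: eq_bigr => j ji; apply: eq_integral => x _; rewrite gE.
have KT : (\int[P]_x G x =
    \prod_(j | j != i) \int[P]_x (g s B j x)%:E)%E.
  have := K setT measurableT; rewrite preimage_setT probability_setT mul1e => <-.
  by apply: eq_integral => x _; rewrite indicE mem_set// mul1e.
rewrite (bigD1 i)//=.
under eq_integral do rewrite (bigD1 i)//= EFinM.
have gi x : g (i :: s) B i x = f i x by rewrite /g mem_head.
under eq_integral do (rewrite gi; under eq_bigr do rewrite gs//).
rewrite (ge0_integralM_indep (mf i) (f0 i) mG G0) ?KT//.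
under [in RHS]eq_integral do rewrite gi.
congr (_ * _)%E; apply: eq_bigr => j ji; apply: eq_integral => x _.
by rewrite gs.
Qed.

(** The absolute values are again independent, so the nonnegative case turns the integral of the
    absolute product into a finite product of finite numbers. *)
Lemma integrable_prod_indep (I : finType) (f : I -> T -> R) :
  (forall i, P.-integrable setT (EFin \o f i)) -> indep_rv f ->
  P.-integrable setT (fun x => (\prod_i f i x)%:E).
Proof.
move=> intf indf.
have mf i : measurable_fun setT (f i).
  by apply/measurable_EFinP; exact: measurable_int (intf i).
apply/integrableP; split.
  by apply/measurable_EFinP; apply: measurable_prod => i _; exact: mf.
under eq_integral do rewrite /= normr_prod.
rewrite (@ge0_integral_prod_indep _ (fun i => (@Num.norm R R) \o f i))//; last 3 first.
- by move=> i; apply: measurableT_comp => //; exact: normr_measurable.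
- by move=> i x; exact: normr_ge0.
- by apply: (indep_rv_comp (h := fun=> (@Num.norm R R))) => // _; exact: normr_measurable.
rewrite (eq_bigr (fun i => (fine (\int[P]_x `|(EFin \o f i) x|))%:E)%E).
  by rewrite prode_EFin ltry.
move=> i _; rewrite fineK//; have /integrableP[_] := intf i.
by rewrite ge0_fin_numE//; exact: integral_ge0.
Qed.

(** Each variable is split into positive and negative parts; expanding the product gives a signed
    sum over all choices [u] of parts, and each term falls under the nonnegative case. *)
Lemma integral_prod_indep (I : finType) (f : I -> T -> R) :
  (forall i, P.-integrable setT (EFin \o f i)) -> indep_rv f ->
  (\int[P]_x (\prod_i f i x)%:E = \prod_i \int[P]_x (f i x)%:E)%E.
Proof.
move=> intf indf.
have mf i : measurable_fun setT (f i).
  by apply/measurable_EFinP; exact: measurable_int (intf i).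
(* [h false] is the positive part and [h true] the negative part. *)
pose h (b : bool) (x : R) : R := Num.max ((-1) ^+ b * x) 0.
have mh b : measurable_fun setT (h b).
  by apply: measurable_maxr => //; exact: measurable_funM.
have h0 b x : 0 <= h b x by rewrite /h le_max lexx orbT.
have hE x : x = \sum_(b : bool) (-1) ^+ b * h b x.
  rewrite /h big_bool/= expr1 expr0 !mul1r !mulN1r.
  by rewrite /Num.max; case: ltP => ?; case: ltP => ?; lra.
have inth b i : P.-integrable setT (EFin \o (h b \o f i)).
  apply: le_integrable (intf i) => //.
    by apply/measurable_EFinP; exact: measurableT_comp.
  move=> x _; rewrite /= lee_fin (ger0_norm (h0 _ _)) ge_max normr_ge0 andbT.
  by rewrite (le_trans (ler_norm _))// normrM normrX normrN1 expr1n mul1r.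
pose e b i := fine (\int[P]_x (h b (f i x))%:E)%E.
have eE b i : (\int[P]_x (h b (f i x))%:E = (e b i)%:E)%E.
  by rewrite fineK//; exact: (integrable_fin_num measurableT (inth b i)).
have indh (u : {ffun I -> bool}) : indep_rv (fun i => h (u i) \o f i).
  exact: (indep_rv_comp (h := fun i => h (u i))).
transitivity (\sum_(u : {ffun I -> bool})
    (\prod_i (-1) ^+ u i)%:E * \int[P]_x (\prod_i h (u i) (f i x))%:E)%E.
  under eq_integral => x _.
    under eq_bigr do rewrite (hE (f _ x)).
    rewrite bigA_distr_bigA/=.
    under eq_bigr do rewrite big_split/=.
    rewrite -sumEFin.
    under eq_bigr do rewrite EFinM.
    over.
  rewrite integral_sum//; last first.
    move=> u; apply: integrableZl => //.
    exact: (integrable_prod_indep (fun i => inth (u i) i)).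
  apply: eq_bigr => u _; rewrite integralZl//.
  exact: (integrable_prod_indep (fun i => inth (u i) i)).
transitivity (\sum_(u : {ffun I -> bool})
    (\prod_i ((-1) ^+ u i * e (u i) i))%:E)%E.
  apply: eq_bigr => u _.
  rewrite (ge0_integral_prod_indep (f := fun i => h (u i) \o f i))//=.
  - by under [X in (_ * X)%E]eq_bigr do rewrite eE; rewrite prode_EFin -EFinM -big_split.
  - by move=> i; exact: measurableT_comp.
rewrite sumEFin -(bigA_distr_bigA (fun (i : I) (b : bool) => (-1) ^+ b * e b i))/= -prode_EFin.
apply: eq_bigr => i _; rewrite -sumEFin.
under [in RHS]eq_integral do rewrite (hE (f i _)) -sumEFin.
under [in RHS]eq_integral do under eq_bigr do rewrite EFinM.
rewrite integral_sum//; last by move=> b; apply: integrableZl => //; exact: inth.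
apply: eq_bigr => b _; rewrite integralZl//; last exact: inth.
by rewrite EFinM eE.
Qed.

End indep_expectation.

(** * Finite product spaces *)

Section product_probability.
Context d1 d2 (T1 : measurableType d1) (T2 : measurableType d2) (R : realType).
Variables (P : probability T1 R) (Q : probability T2 R).

Lemma product_measure12 (C : set (T1 * T2)) : measurable C ->
  (P \x Q)%E C = (P \x^ Q)%E C.
Proof.
move=> mC; apply: product_measure_unique => // A1 A2 mA1 mA2.
exact: product_measure2E.
Qed.

Lemma measurable_prod_map (tau : T1 -> T1) (S : T2 -> T2) :
  measurable_fun setT tau -> measurable_fun setT S ->
  measurable_fun setT (fun z : T1 * T2 => (tau z.1, S z.2)).
Proof.
move=> mt mS; apply: measurable_fun_pair.
  exact: (measurableT_comp mt (@measurable_fst _ _ T1 T2)).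
exact: (measurableT_comp mS (@measurable_snd _ _ T1 T2)).
Qed.

(** The two coordinates are moved one at a time through the intermediate set [D]: sections over the
    first factor bound the effect of [S], sections over the second that of [tau]. *)
Lemma product_measure_shift (tau : T1 -> T1) (S : T2 -> T2) (k l : R) :
  measurable_fun setT tau -> measurable_fun setT S -> 0 <= k -> 0 <= l ->
  (forall C, measurable C -> P (tau @^-1` C) <= k%:E * P C)%E ->
  (forall C, measurable C -> Q (S @^-1` C) <= l%:E * Q C)%E ->
  forall C, measurable C ->
  ((P \x Q) ((fun z => (tau z.1, S z.2)) @^-1` C) <= (k * l)%:E * (P \x Q) C)%E.
Proof.
move=> mt mS k0 l0 tP SQ C mC.
pose D := (fun z : T1 * T2 => (tau z.1, z.2)) @^-1` C.
have mD : measurable D.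
  rewrite -[X in measurable X]setTI.
  exact: (measurable_prod_map mt (@measurable_id _ T2 setT)).
have mE : measurable ((fun z : T1 * T2 => (tau z.1, S z.2)) @^-1` C).
  by rewrite -[X in measurable X]setTI; exact: (measurable_prod_map mt mS).
apply: (@le_trans _ _ (l%:E * (P \x Q) D)%E).
  rewrite /product_measure1 -ge0_integralZl//; last exact: measurable_fun_xsection.
  apply: ge0_le_integral => //.
  - exact: measurable_fun_xsection.
  - apply: emeasurable_funM => //; exact: measurable_fun_xsection.
  move=> x _ /=; have := SQ _ (measurable_xsection x mD); congr (Q _ <= _)%E.
rewrite mulrC EFinM -muleA; apply: lee_wpmul2l; first by rewrite lee_fin.
rewrite !product_measure12//.
rewrite /product_measure2 -ge0_integralZl//; last exact: measurable_fun_ysection.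
apply: ge0_le_integral => //.
- exact: measurable_fun_ysection.
- apply: emeasurable_funM => //; exact: measurable_fun_ysection.
move=> x _ /=; have := tP _ (measurable_ysection x mC); congr (P _ <= _)%E.
Qed.

End product_probability.

(** Iterated binary products. The last clause lifts maps of the factors to the product with the
    distortion constants multiplied; this is how privacy budgets add up over independent noises. *)
Lemma product_space (R : realType) d1 (Om1 : measurableType d1) (n : nat)
    (P1 : nat -> probability Om1 R) :
  exists d (Om : measurableType d) (P : probability Om R)
         (pi : 'I_n -> Om -> Om1),
  [/\ forall i, measurable_fun setT (pi i),
      forall F : 'I_n -> set Om1, (forall i, measurable (F i)) ->
        P (\bigcap_i (pi i @^-1` F i)) = (\prod_(i < n) P1 i (F i))%E
    & forall (tau : 'I_n -> Om1 -> Om1) (K : 'I_n -> R),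
      (forall i, measurable_fun setT (tau i)) -> (forall i, 0 <= K i) ->
      (forall (i : 'I_n) C, measurable C -> P1 i (tau i @^-1` C) <= (K i)%:E * P1 i C)%E ->
      exists S : Om -> Om, [/\ measurable_fun setT S,
        forall i w, pi i (S w) = tau i (pi i w)
      & forall C, measurable C ->
          (P (S @^-1` C) <= (\prod_(i < n) K i)%:E * P C)%E]].
Proof.
elim: n P1 => [|n IH] P1.
  (* For [n = 0] any probability space will do; indexing [P1] by [nat] makes [P1 0] available. *)
  exists d1, Om1, (P1 0%N), (fun=> id); split => //.
  - move=> F _; rewrite big_ord0 (_ : \bigcap_i _ = setT) ?probability_setT//.
    by rewrite -subTset => x _ [].
  - move=> tau K _ _ _; exists id; split => //; first by case.
    by move=> C _; rewrite big_ord0 mul1e.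
have [d [Om [P [pi [mpi Ppi Spi]]]]] := IH (fun k => P1 k.+1).
exists _, (Om1 * Om)%type, (P1 0%N \x P)%E,
  (fun i z => if unlift ord0 i is Some j then pi j z.2 else z.1).
split.
- move=> i; case: unliftP => [j _|_].
    exact: (measurableT_comp (mpi j) (@measurable_snd _ _ Om1 Om)).
  exact: measurable_fst.
- move=> F mF.
  rewrite (_ : \bigcap_i _ = F ord0 `*`
    \bigcap_j (pi j @^-1` F (lift ord0 j))); last first.
    apply/seteqP; split => [[y w] H|[y w] [/= Hy Hw] i _] /=.
      split => [|j _]/=; first by have := H ord0 Logic.I; rewrite /= unlift_none.
      by have := H (lift ord0 j) Logic.I; rewrite /= liftK.
    by case: unliftP => [j ->|->] //; exact: Hw.
  rewrite big_ord_recl -Ppi//; apply: product_measure1E => //.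
  apply: fin_bigcap_measurable => // j _.
  by rewrite -[X in measurable X]setTI; exact: mpi.
- move=> tau K mtau K0 HK.
  have [|||S [mS Spi' SP]] := Spi (fun j => tau (lift ord0 j)) (fun j => K (lift ord0 j)) => //.
    by move=> i; exact: HK.
  exists (fun z => (tau ord0 z.1, S z.2)); split.
  + exact: measurable_prod_map.
  + by move=> i [y w]; case: unliftP => [j ->|->] /=.
  + move=> C mC; rewrite big_ord_recl.
    apply: product_measure_shift => //; first exact: prodr_ge0.
    exact: HK.
Qed.

Lemma product_marginal (R : realType) d d1 (Om : measurableType d)
    (Om1 : measurableType d1) (n : nat) (P : probability Om R)
    (P1 : 'I_n -> probability Om1 R) (pi : 'I_n -> Om -> Om1) :
  (forall F : 'I_n -> set Om1, (forall i, measurable (F i)) ->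
    P (\bigcap_i (pi i @^-1` F i)) = (\prod_(i < n) P1 i (F i))%E) ->
  forall i B, measurable B -> P (pi i @^-1` B) = P1 i B.
Proof.
move=> Ppi i B mB; have := Ppi (fun i' => if i' == i then B else setT).
rewrite (_ : \bigcap_i _ = pi i @^-1` B); last first.
  apply/seteqP; split => w H; first by have := H i Logic.I; rewrite eqxx.
  by move=> i' _; case: eqP => // ->.
move=> ->; last by move=> i'; case: eqP.
rewrite (bigD1 i)//= eqxx big1 ?mule1// => i' /negbTE ->.
exact: probability_setT.
Qed.

(** * Staircase noise *)

Section stacked_intervals.
Context (R : realType).
Local Notation leb := (@lebesgue_measure R).

Lemma measurable_shift (s : R) : measurable_fun setT (fun x : R => x + s).
Proof. exact: measurable_funD. Qed.

(** The image of Lebesgue measure under the translation agrees with it on half-open intervals, which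
    determine it. *)
Lemma lebesgue_measure_shift (s : R) (A : set R) : measurable A ->
  leb ((fun x => x + s) @^-1` A) = leb A.
Proof.
move=> mA; have ms := measurable_shift s.
pose phi : {mfun measurableTypeR R >-> measurableTypeR R} :=
  HB.pack (fun x : measurableTypeR R => x + s : measurableTypeR R)
          (isMeasurableFun.Build _ _ (measurableTypeR R) (measurableTypeR R) _ ms).
apply/esym; apply: (@lebesgue_measure_unique R (pushforward leb phi)) => //.
move=> _ [[a b]] _ <-; transitivity (leb (`]a - s, b - s]%classic : set R)).
  rewrite !lebesgue_measure_itv/= !lte_fin ltrD2r -!EFinB; case: ifP => // _.
  by congr EFin; ring.
congr (leb _); apply/seteqP.
by split => x/=; rewrite !in_itv/= ltrBlDr lerBrDr.
Qed.

Context (w : nat -> {nonneg R}) (r : nat -> R).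

Definition stack_itv k : set R := `[- r k, r k]%classic.

Lemma measurable_stack_itv k : measurable (stack_itv k).
Proof. exact: measurable_itv. Qed.

Definition stack_layer k : {measure set (measurableTypeR R) -> \bar R} :=
  mscale (w k) (mrestr leb (measurable_stack_itv k)).

(** The measure with density the sum over [k] of [w k] times the indicator of [[- r k, r k]]. *)
Definition stack : {measure set (measurableTypeR R) -> \bar R} :=
  mseries stack_layer 0.

Lemma stackE B :
  (stack B = \sum_(k <oo) (w k)%:num%:E * leb (B `&` stack_itv k))%E.
Proof. by []. Qed.

Lemma stack_shift (K s : R) (B : set R) : measurable B -> `|s| <= 1 ->
  (forall k, r k + 1 <= r k.+1) -> (forall k, (w k)%:num <= K * (w k.+1)%:num) ->
  (stack ((fun x => x + s)%R @^-1` B) <= K%:E * stack B)%E.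
Proof.
move=> mB s1 rS wS.
have mI k : measurable (B `&` stack_itv k).
  by apply: measurableI => //; exact: measurable_stack_itv.
pose u k := ((w k)%:num%:E * leb (B `&` stack_itv k))%E.
have u0 k : (0 <= u k)%E by rewrite mule_ge0// lee_fin.
apply: (@le_trans _ _ (K%:E * \sum_(k <oo) u (k + 1)%N)%E); last first.
  (* A negative [K] forces all weights, hence both sides, to be zero. *)
  have [K0|K0] := leP 0 K; last first.
    have wk k : (w k)%:num = 0 :> R.
      apply/eqP; rewrite eq_le (ge0 (w k)) andbT.
      by rewrite (le_trans (wS k))// mulr_le0_ge0// ltW.
    rewrite !eseries0 ?stackE ?eseries0 ?mule0// => k _ _; by rewrite /u wk mul0e.
  rewrite lee_wpmul2l ?lee_fin// stackE nneseries_addn//.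
  rewrite [leRHS](nneseries_split 0 1)//; last by move=> k _; exact: u0.
  by apply: leeDr; apply: sume_ge0 => k _; exact: u0.
rewrite -nneseriesZl; last by move=> k _; exact: u0.
rewrite stackE; apply: lee_nneseries.
  by move=> k _ _; rewrite mule_ge0// lee_fin.
move=> k _; rewrite /u addn1 muleA -EFinM; apply: lee_pmul => //.
  by rewrite lee_fin.
rewrite -(@lebesgue_measure_shift s (_ `&` _))//; apply: le_measure; rewrite ?inE.
- apply: measurableI; last exact: measurable_stack_itv.
  by rewrite -[X in measurable X]setTI; exact: measurable_shift.
- by rewrite -[X in measurable X]setTI; exact: measurable_shift.
- move=> x [Bx]; rewrite /stack_itv/= !in_itv/= => /andP[h1 h2]; split => //.
  move: s1 (rS k); rewrite ler_norml => /andP[h3 h4] h5.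
  by apply/andP; split; lra.
Qed.

Lemma stackN (B : set R) : measurable B -> stack (-%R @^-1` B) = stack B.
Proof.
move=> mB; rewrite !stackE; apply: eq_eseriesr => k _; congr (_ * _)%E.
rewrite -[RHS]lebesgue_measureN; last first.
  by apply: measurableI => //; exact: measurable_stack_itv.
congr (leb _); apply/seteqP; split => x [Bx]; rewrite /stack_itv/= !in_itv/= => h;
  by split => //; rewrite ?in_itv/=; lra.
Qed.

Lemma stack_mass : (forall k, 0 <= r k) ->
  (stack setT = \sum_(k <oo) ((w k)%:num * (2 * r k))%:E)%E.
Proof.
move=> r0; rewrite stackE; apply: eq_eseriesr => k _; rewrite EFinM setTI.
rewrite /stack_itv lebesgue_measure_itv/= lte_fin opprK -EFinD.
have := r0 k; rewrite le_eqVlt => /orP[/eqP <-|rk].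
  by rewrite oppr0 ltxx mulr0.
rewrite gtrN//; congr (_ * _%:E)%E; ring.
Qed.

Lemma integral_sqr_itv (a : R) : 0 <= a ->
  (\int[leb]_(x in `[(- a)%R, a]) (x ^+ 2)%:E = (2 / 3 * a ^+ 3)%:E)%E.
Proof.
rewrite le_eqVlt => /orP[/eqP <-|a0].
  by rewrite oppr0 set_itv1 integral_set1 expr0n/= mulr0.
pose F (x : R) : R := 3^-1 * x ^+ 3.
have dF (x : R) : derivable F x 1 /\ 'D_1 F x = x ^+ 2.
  have d : is_derive x 1 F (x ^+ 2).
    by apply: is_derive_eq; rewrite /GRing.scale/=; field.
  by case: d => dx dE; split.
have cF (x : R) : {for x, continuous F}.
  by apply: differentiable_continuous; apply/derivable1_diffP; exact: (dF x).1.
rewrite (@continuous_FTC2 _ _ F); last 4 first.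
- by rewrite gtrN.
- by apply: continuous_subspaceT => x; exact: exprn_continuous.
- split.
  + by move=> x _; exact: (dF x).1.
  + exact/cvg_at_right_filter/cF.
  + exact/cvg_at_left_filter/cF.
- by move=> x _; rewrite derive1E; exact: (dF x).2.
by rewrite -EFinB /F; congr EFin; field.
Qed.

Lemma stack_sqr : (forall k, 0 <= r k) ->
  (\int[stack]_x (x ^+ 2)%:E =
   \sum_(k <oo) ((w k)%:num * (2 / 3 * r k ^+ 3))%:E)%E.
Proof.
move=> r0.
have mX D : measurable_fun D (fun x : measurableTypeR R => (x ^+ 2)%:E).
  by apply/measurable_EFinP; exact: measurable_funX.
have X0 (x : R) : (0 <= (x ^+ 2)%:E)%E by rewrite lee_fin sqr_ge0.
rewrite ge0_integral_measure_series//; apply: eq_eseriesr => k _.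
rewrite ge0_integral_mscale// EFinM; congr (_ * _)%E.
have mI := measurable_stack_itv k.
rewrite (@ge0_negligible_integral _ (measurableTypeR R) R (mrestr leb mI) setT
  (~` stack_itv k))//; last 2 first.
- exact: measurableC.
- by rewrite /= /mrestr setICl measure0.
rewrite setTD setCK (@eq_measure_integral _ _ _ _ leb).
  by rewrite /stack_itv integral_sqr_itv.
by move=> A _ AI; rewrite /= /mrestr setIidl.
Qed.

End stacked_intervals.

(** * Moment series of the staircase law *)

Section staircase_series.
Context (R : realType) (t : R).
Hypotheses (t0 : 0 < t) (t1 : t < 1).

Let b := t ^+ 3.
Let g := (t - t ^+ 3) / (1 - t ^+ 3).

Let b0 : 0 < b. Proof. exact: exprn_gt0. Qed.
Let b1 : b < 1. Proof. by rewrite exprn_ilt1// ltW. Qed.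
Let nb : 1 - b != 0. Proof. by rewrite subr_eq0 gt_eqF. Qed.

Let g0 : 0 <= g.
Proof.
rewrite divr_ge0// subr_ge0; last exact: ltW.
by rewrite ler_iXnr// ltW.
Qed.

(** [G y] and [F y] are the closed forms of the series of [b ^+ k * (k + y)] and
    [b ^+ k * (k + y) ^+ 3]. The tail from [n] on is [b ^+ n] times the same function at [n + y],
    whence the partial sums below. *)
Let e := b / (1 - b).
Let G y := (y + e) / (1 - b).
Let F y := (y ^+ 3 + 3 * e * y ^+ 2 + 3 * (b * (1 + b) / (1 - b) ^+ 2) * y
            + b * (1 + 4 * b + b ^+ 2) / (1 - b) ^+ 3) / (1 - b).

Let e0 : 0 <= e. Proof. by apply: divr_ge0; rewrite ?subr_ge0 ltW. Qed.

Let sum1 n : \sum_(0 <= k < n) b ^+ k * (k%:R + g) = G g - b ^+ n * G (n%:R + g).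
Proof.
elim: n => [|n IH]; first by rewrite big_geq// expr0 mul1r add0r subrr.
rewrite big_nat_recr//= IH [b ^+ n.+1]exprSr -natr1 /G /e; move: (b ^+ n) (n%:R) => x y.
by field.
Qed.

Let sum3 n :
  \sum_(0 <= k < n) b ^+ k * (k%:R + g) ^+ 3 = F g - b ^+ n * F (n%:R + g).
Proof.
elim: n => [|n IH]; first by rewrite big_geq// expr0 mul1r add0r subrr.
rewrite big_nat_recr//= IH [b ^+ n.+1]exprSr -natr1 /F /e; move: (b ^+ n) (n%:R) => x y.
by field.
Qed.

Let V := (t ^+ 2 + t ^+ 3) / (1 - t ^+ 3) ^+ 2.

(** The normalized law has variance [F g / (3 * G g)], so this is the bound of the variance by [V];
    for this [g] the difference simplifies to a fraction of evident sign. *)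
Let FG : F g <= 3 * V * G g.
Proof.
rewrite -subr_ge0.
have -> : 3 * V * G g - F g = (t ^+ 3 - t ^+ 6) / (1 - t ^+ 3) ^+ 4.
  by rewrite /V /G /F /e /g /b; field.
rewrite divr_ge0 ?exprn_ge0// subr_ge0; last exact: ltW.
by rewrite ler_wiXn2l// ltW.
Qed.

(** A cubic eventually dominates a linear function. Applied to the tails, this makes the comparison
    of [F g] with [3 * V * G g] hold already between long partial sums, without computing the limit
    of the tails. *)
Let FG_large (y : R) : 1 + 3 * V * (1 + e) <= y -> 3 * V * G y <= F y.
Proof.
move=> yV.
have V0 : 0 <= V by rewrite divr_ge0 ?sqr_ge0// addr_ge0// exprn_ge0// ltW.
have Ve0 : 0 <= 3 * V * (1 + e).
  apply: mulr_ge0; [apply: mulr_ge0|apply: addr_ge0] => //.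
have y1 : 1 <= y by lra.
have y0 : 0 <= y by exact: le_trans y1.
rewrite /G /F mulrA ler_pM2r ?invr_gt0 ?subr_gt0//.
apply: (@le_trans _ _ (y ^+ 3)); last first.
  have B0 := ltW b0.
  have q0 : 0 <= 1 + 4 * b + b ^+ 2 by move: (b) B0 => c c0; nra.
  have nb0 n : 0 <= (1 - b) ^+ n by apply: exprn_ge0; rewrite subr_ge0 ltW.
  apply: ler_wpDr; first by apply: divr_ge0 => //; exact: mulr_ge0.
  apply: ler_wpDr.
    apply: mulr_ge0 => //; apply: mulr_ge0 => //; apply: divr_ge0 => //.
    by apply: mulr_ge0 => //; exact: addr_ge0.
  by apply: ler_wpDr => //; apply: mulr_ge0; [apply: mulr_ge0|apply: exprn_ge0].
apply: (@le_trans _ _ (3 * V * (1 + e) * y)).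
  have -> : 3 * V * (1 + e) * y = 3 * V * (y + e * y) by ring.
  apply: ler_wpM2l; first exact: mulr_ge0.
  by rewrite lerD2l; exact: ler_peMr.
apply: (@le_trans _ _ (y * y)).
  by rewrite ler_wpM2r//; lra.
by rewrite exprS expr2 ler_wpM2l// ler_peMr.
Qed.

Lemma staircase_series : exists m v : R,
  [/\ 0 < m, 0 < v, v <= 3 * V * m,
      (\sum_(k <oo) (b ^+ k * (k%:R + g))%:E = m%:E)%E &
      (\sum_(k <oo) (b ^+ k * (k%:R + g) ^+ 3)%:E = v%:E)%E].
Proof.
pose u i k := (b ^+ k * (k%:R + g) ^+ i)%:E.
have kg0 k : 0 <= k%:R + g by rewrite addr_ge0.
have u0 i k : (0 <= u i k)%E by rewrite lee_fin mulr_ge0 ?exprn_ge0// ltW.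
have up i : (0 < \sum_(k <oo) u i k)%E.
  (* Positivity comes from the term [k = 1], since only [0 <= g] is at hand for the term [k = 0]. *)
  apply: lt_le_trans (nneseries_lim_ge 2 (fun k _ _ => u0 i k)) => /=.
  rewrite big_nat_recr//= (lt_le_trans _ (leeDr _ _))//; last first.
    by apply: sume_ge0 => k _; exact: u0.
  by rewrite lte_fin mulr_gt0 ?exprn_gt0// ltr_wpDr.
have le1 : (\sum_(k <oo) u 1%N k <= (G g)%:E)%E.
  apply: lime_le; first by apply: is_cvg_nneseries => k _ _; exact: u0.
  apply: nearW => n; rewrite sumEFin lee_fin.
  under eq_bigr do rewrite expr1.
  rewrite sum1 gerBl; apply: mulr_ge0; first by apply: exprn_ge0; exact: ltW.
  by apply: divr_ge0; [exact: addr_ge0|rewrite subr_ge0 ltW].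
have le3 : (\sum_(k <oo) u 3%N k <= (3 * V)%:E * \sum_(k <oo) u 1%N k)%E.
  apply: lime_le; first by apply: is_cvg_nneseries => k _ _; exact: u0.
  near=> n.
  apply: (@le_trans _ _ ((3 * V)%:E * \sum_(0 <= k < n) u 1%N k)%E); last first.
    rewrite lee_wpmul2l ?lee_fin//.
      by rewrite mulr_ge0// divr_ge0 ?sqr_ge0// addr_ge0// exprn_ge0// ltW.
    by apply: nneseries_lim_ge => k _ _; exact: u0.
  rewrite !sumEFin -EFinM lee_fin; under [in leRHS]eq_bigr do rewrite expr1.
  rewrite sum1 sum3 mulrBr lerB ?FG// mulrCA ler_wpM2l ?exprn_ge0//; first exact: ltW.
  apply: FG_large; rewrite (@le_trans _ _ n%:R) ?lerDl//.
  near: n; exact: nbhs_infty_ger.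
have fin1 : (\sum_(k <oo) u 1%N k)%E \is a fin_num.
  by rewrite ge0_fin_numE ?(le_lt_trans le1) ?ltry// ltW.
have fin3 : (\sum_(k <oo) u 3%N k)%E \is a fin_num.
  rewrite ge0_fin_numE ?(le_lt_trans le3)//; last exact: ltW.
  by rewrite -(fineK fin1) -EFinM ltry.
exists (fine (\sum_(k <oo) u 1%N k)%E), (fine (\sum_(k <oo) u 3%N k)%E); split.
- by rewrite fine_gt0// up ltey_eq fin1.
- by rewrite fine_gt0// up ltey_eq fin3.
- by rewrite -lee_fin EFinM !fineK.
- by rewrite fineK//; apply: eq_eseriesr => k _; rewrite /u expr1.
- by rewrite fineK.
Unshelve. all: by end_near.
Qed.

End staircase_series.

(** * Integrals along measure-preserving maps, and the staircase distribution *)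

Section measure_preserving.
Context d1 d2 (X : measurableType d1) (Y : measurableType d2) (R : realType).
Variables (P : probability X R) (Q : probability Y R) (phi : X -> Y).
Hypothesis mphi : measurable_fun setT phi.
Hypothesis PQ : forall B, measurable B -> P (phi @^-1` B) = Q B.

Let phi_pack : {mfun X >-> Y} :=
  HB.pack phi (isMeasurableFun.Build _ _ X Y phi mphi).

Let eq_PQ D (f : Y -> \bar R) : measurable D ->
  (\int[pushforward P phi]_(y in D) f y = \int[Q]_(y in D) f y)%E.
Proof.
move=> mD.
apply: (@eq_measure_integral _ _ _ D Q (pushforward P phi_pack)) => A mA _.
exact: PQ.
Qed.

Lemma integrable_preserving (f : Y -> \bar R) :
  Q.-integrable setT f -> P.-integrable setT (f \o phi).
Proof.
move=> /integrableP[mf foo]; apply/integrableP; split; first exact: measurableT_comp.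
rewrite -[X in (X < _)%E]/(\int[P]_(x in setT) ((abse \o f) \o phi) x)%E.
rewrite -(preimage_setT phi) -ge0_integral_pushforward//; last 2 first.
- exact: measurableT_comp.
- by move=> y _ /=; exact: abse_ge0.
by rewrite eq_PQ.
Qed.

Lemma integral_preserving (f : Y -> \bar R) :
  Q.-integrable setT f -> (\int[P]_x f (phi x) = \int[Q]_y f y)%E.
Proof.
move=> fQ; rewrite -[RHS]eq_PQ// integral_pushforward//.
- by have /integrableP[] := fQ.
- exact: integrable_preserving.
Qed.

End measure_preserving.

Lemma symmetric_mean0 (R : realType) (P : probability (measurableTypeR R) R) :
  P.-integrable setT (EFin : measurableTypeR R -> \bar R) ->
  (forall B : set (measurableTypeR R), measurable B -> P (-%R @^-1` B) = P B) ->
  (\int[P]_x x%:E = 0)%E.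
Proof.
move=> iP sP.
have mN : measurable_fun setT (-%R : measurableTypeR R -> measurableTypeR R).
  exact: oppr_measurable.
have fP := integrable_fin_num measurableT iP.
have := integral_preserving mN sP iP.
under eq_integral do rewrite EFinN.
rewrite integralN//; last exact: integrable_add_def.
by rewrite -(fineK fP) -EFinN => -[] /eqP; rewrite eqNr => /eqP ->.
Qed.

Lemma staircase_noise (R : realType) (t : R) : 0 < t -> t < 1 ->
  exists (P : probability (measurableTypeR R) R) (v : R),
  [/\ 0 < v, v <= (t ^+ 2 + t ^+ 3) / (1 - t ^+ 3) ^+ 2,
      zero_mean P (id : measurableTypeR R -> R),
      (\int[P]_x (x ^+ 2)%:E = v%:E)%E
    & forall s, `|s| <= 1 -> forall C : set (measurableTypeR R), measurable C ->
      (P ((fun x => x + s)%R @^-1` C) <= ((t ^+ 3)^-1)%:E * P C)%E].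
Proof.
move=> t0 t1; have [m [v [m0 v0 vm sm sv]]] := staircase_series t0 t1.
set b := t ^+ 3 in vm sm sv *.
set g := (t - t ^+ 3) / (1 - t ^+ 3) in sm sv.
have b0 : 0 < b by exact: exprn_gt0.
have g0 : 0 <= g.
  rewrite divr_ge0 ?subr_ge0//; first by rewrite ler_iXnr// ltW.
  by rewrite exprn_ile1// ltW.
(* Layer [k] has length [2 * r k], so [2 * m] is the mass to normalize by. Its second moment is
   [2 / 3 * r k ^+ 3], which makes the variance [v / (3 * m)]. *)
have w0 k : 0 <= b ^+ k / (2 * m).
  by rewrite divr_ge0 ?exprn_ge0 ?mulr_ge0// ltW.
pose w k := NngNum (w0 k).
pose r k : R := k%:R + g.
have r0 k : 0 <= r k by rewrite addr_ge0.
have mass : stack w r setT = 1%E.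
  rewrite stack_mass//=.
  rewrite (eq_eseriesr (g := fun k => (m^-1)%:E * (b ^+ k * (k%:R + g))%:E)%E).
    rewrite nneseriesZl; last first.
      by move=> k _; rewrite lee_fin mulr_ge0 ?exprn_ge0 ?r0// ltW.
    by rewrite sm -EFinM mulVf ?gt_eqF.
  by move=> k _; rewrite -EFinM /r; congr EFin; field; rewrite gt_eqF.
pose P : probability (measurableTypeR R) R :=
  HB.pack (mseries (stack_layer w r) 0)
    (Measure_isProbability.Build _ _ _ (mseries (stack_layer w r) 0) mass).
have sqr : (\int[P]_x (x ^+ 2)%:E = (v / (3 * m))%:E)%E.
  rewrite [LHS]stack_sqr//.
  rewrite (eq_eseriesr
    (g := fun k => ((3 * m)^-1)%:E * (b ^+ k * (k%:R + g) ^+ 3)%:E)%E).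
    rewrite nneseriesZl; last first.
      by move=> k _; rewrite lee_fin mulr_ge0 ?exprn_ge0 ?r0// ltW.
    by rewrite sv -EFinM mulrC.
  by move=> k _; rewrite -EFinM /r/=; congr EFin; field; rewrite gt_eqF.
have m3 : 0 < 3 * m by exact: mulr_gt0.
exists P, (v / (3 * m)); split => //.
- exact: divr_gt0.
- by rewrite ler_pdivrMr// mulrCA mulrA.
- have i : P.-integrable setT (EFin : measurableTypeR R -> \bar R).
    (* The first moment is finite because [|x| <= 1 + x ^+ 2]. *)
    have i2 : P.-integrable setT (fun x : measurableTypeR R => (1 + x ^+ 2)%:E).
      apply/integrableP; split.
        by apply/measurable_EFinP; apply: measurable_funD => //; exact: measurable_funX.
      under eq_integral do rewrite /= ger0_norm ?addr_ge0 ?sqr_ge0// EFinD.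
      rewrite ge0_integralD//; last 2 first.
      + by move=> x _; rewrite lee_fin sqr_ge0.
      + by apply/measurable_EFinP; exact: measurable_funX.
      rewrite sqr integral_cst// [X in (1 * X)%E](_ : _ = 1%E); last exact: mass.
      by rewrite mule1 -EFinD ltry.
    apply: le_integrable i2 => //.
    move=> x _; rewrite /= lee_fin [leRHS]ger0_norm ?addr_ge0 ?sqr_ge0//.
    rewrite ler_norml; apply/andP; split; nra.
  split => //; apply: symmetric_mean0 => // B mB; exact: stackN.
- move=> s s1 C mC; apply: stack_shift => //.
  + by move=> k; rewrite /r -natr1; lra.
  + by move=> k /=; rewrite exprS -[in leRHS]mulrA mulKf ?gt_eqF.
Qed.

(** * Noise of the nodes for one input *)

(** At [eps] itself the inequality is strict, because the factors [2 ^ (2 / 3) >= 1] and [1 + u > 1]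
    only enlarge the numerator; continuity keeps it true slightly to the left. *)
Lemma eps_slack (R : realType) (eps : R) : 0 < eps ->
  exists2 eps', 0 < eps' < eps &
    let t := expR (- (eps' / 3)) in
    (t ^+ 2 + t ^+ 3) / (1 - t ^+ 3) ^+ 2 <= sigma_star_sq eps.
Proof.
move=> eps0.
pose h (x : R) := let t := expR (- (x / 3)) in
  (t ^+ 2 + t ^+ 3) / (1 - t ^+ 3) ^+ 2.
have t3 (x : R) : expR (- (x / 3)) ^+ 3 = expR (- x).
  by rewrite -expRM_natl; congr expR; field.
have t2 (x : R) : expR (- (x / 3)) ^+ 2 = expR (- (2 * x / 3)).
  by rewrite -expRM_natl; congr expR; field.
have b1 : expR (- eps) < 1 by rewrite expR_lt1 oppr_lt0.
have hlt : h eps < sigma_star_sq eps.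
  rewrite /h /sigma_star_sq t2 t3 ltr_pM2r; last first.
    by rewrite invr_gt0 exprn_gt0// subr_gt0.
  rewrite ltrD2r.
  have p : 1 <= (2 : R) `^ (2 / 3).
    by rewrite -[leLHS](powRr0 (2 : R)) ler_powR//; lra.
  set u := expR _; have u0 : 0 < u by exact: expR_gt0.
  rewrite -mulrA; move: p u0; move: (_ `^ _) (u) => p u' p1 u0; nra.
have cE : expR (- (x / 3)) @[x --> eps] --> expR (- (eps / 3)).
  apply: (@cvg_comp _ _ _ (fun x : R => - (x / 3)) expR); last exact: continuous_expR.
  by apply: cvgN; apply: cvgM; [exact: cvg_id|exact: cvg_cst].
have cX k : expR (- (x / 3)) ^+ k @[x --> eps] --> expR (- (eps / 3)) ^+ k.
  exact: (cvg_comp _ _ cE (@exprn_continuous _ k _)).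
have ch : h x @[x --> eps] --> h eps.
  apply: cvgM; first exact: cvgD.
  apply: cvgV; first by rewrite t3 expf_neq0// subr_eq0 gt_eqF.
  apply: (@cvg_comp _ _ _ (fun x : R => 1 - expR (- (x / 3)) ^+ 3) (fun x => x ^+ 2));
    last exact: exprn_continuous.
  by apply: cvgB => //; exact: cvg_cst.
have H : \forall x \near eps, 0 < x /\ h x < sigma_star_sq eps.
  apply: filterI; first exact: lt_nbhsr.
  by apply: cvgr_lt ch _ hlt.
have [x /= [[x0 xh] xe]] : exists x : R, (0 < x /\ h x < sigma_star_sq eps) /\ x < eps.
  have := @nbhs_left_lt _ eps; move=> L.
  have L2 : \forall x \near eps^'-, 0 < x /\ h x < sigma_star_sq eps.
    by apply: cvg_within; exact: H.
  by apply: (@filter_ex _ eps^'-); exact: filterI.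
by exists x; [rewrite x0|exact: ltW].
Qed.

(** Index [ord0] is the main noise and the other indices are the masks. Privacy is expressed by a
    map [S] of the sample space that realizes the shift, so that it passes to every function of the
    noises. *)
Lemma base_noise (R : realType) (n : nat) (eps : R) : 0 < eps ->
  exists d (Om : measurableType d) (P : probability Om R)
         (X : 'I_n.+1 -> Om -> R) (v : 'I_n.+1 -> R),
  [/\ (forall l, zero_mean P (X l)) /\ (forall l, 0 <= v l),
      v ord0 = sigma_star_sq eps,
      forall l l', P.-integrable setT (fun w => (X l w * X l' w)%:E),
      forall l l', (\int[P]_w (X l w * X l' w)%:E =
        (if l == l' then v l else 0)%:E)%E
    & forall s : 'I_n.+1 -> R, `|s ord0| <= 1 -> (forall l, `|s l| <= n.+1%:R) ->
      exists S : Om -> Om, [/\ measurable_fun setT S,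
        forall l w, X l (S w) = X l w + s l
      & forall C, measurable C -> (P (S @^-1` C) <= (expR eps)%:E * P C)%E]].
Proof.
move=> eps0.
have [eps' /andP[eps'0 eps'lt]] := eps_slack eps0.
set t := expR _ => /= tV.
have texp (x : R) : 0 < x -> 0 < expR (- (x / 3)) < 1.
  by move=> x0; rewrite expR_gt0 expR_lt1 oppr_lt0 divr_gt0.
have t3 (x : R) : (expR (- (x / 3)) ^+ 3)^-1 = expR x.
  by rewrite -expRM_natl -expRN; congr expR; field.
have /andP[t0 t1] := texp _ eps'0.
(* The spare budget is shared among the [n] masks; dividing by [n.+1] also covers [n = 0]. *)
pose eps2 := (eps - eps') / n.+1%:R.
have eps20 : 0 < eps2 by rewrite divr_gt0 ?subr_gt0.
have /andP[u0 u1] := texp _ eps20.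
have [P0 [v0 [v0p v0V m0 sq0 dp0]]] := staircase_noise t0 t1.
have [P2 [v2 [v2p v2V m2 sq2 dp2]]] := staircase_noise u0 u1.
rewrite t3 in dp0; rewrite t3 in dp2.
pose PP k := if k is 0%N then P0 else P2.
have [d [Om [P [pi [mpi Ppi Spi]]]]] := product_space n.+1 PP.
have sp : 0 < sigma_star_sq eps by exact: lt_le_trans (lt_le_trans v0p v0V) tV.
(* This scaling makes the variance of the main noise exactly [sigma_star_sq eps]; as [k0 >= 1],
   shifts of size at most 1 remain so after division by it. *)
pose k0 := Num.sqrt (sigma_star_sq eps / v0).
have k01 : 1 <= k0.
  rewrite -sqrtr1 ler_wsqrtr// ler_pdivlMr// mul1r.
  exact: le_trans v0V tV.
(* Stretching the masks by [n.+1] turns their shifts, of size at most [n.+1], into shifts by at most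
   1 of the staircase law. *)
pose k (l : 'I_n.+1) := if l == ord0 then k0 else n.+1%:R.
have k1 l : 1 <= k l by rewrite /k; case: ifP => // _; rewrite ler1n.
have kp l : 0 < k l by exact: lt_le_trans (k1 l).
pose vv (l : 'I_n.+1) := if l == ord0 then sigma_star_sq eps else n.+1%:R ^+ 2 * v2.
have marg := @product_marginal _ _ _ _ _ _ _ (fun l : 'I_n.+1 => PP l) _ Ppi.
have mPP l : zero_mean (PP l) (id : measurableTypeR R -> R) by rewrite /PP; case: l.
have sqPP l : (\int[PP l]_x (x ^+ 2)%:E = (if l is 0%N then v0 else v2)%:E)%E.
  by rewrite /PP; case: l.
have ind : indep_rv P pi.
  move=> B mB; rewrite Ppi; last exact: mB.
  by apply: eq_bigr => l _; apply/esym/marg; exact: mB.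
have ipi l : P.-integrable setT (EFin \o pi l).
  exact: (integrable_preserving (mpi l) (marg l) (mPP l).1).
have Epi l : (\int[P]_w (pi l w)%:E = 0)%E.
  by rewrite (integral_preserving (mpi l) (marg l) (mPP l).1); exact: (mPP l).2.
have isq l : (PP l).-integrable setT (fun x : measurableTypeR R => (x ^+ 2)%:E).
  apply/integrableP; split.
    by apply/measurable_EFinP; exact: measurable_funX.
  under eq_integral do rewrite /= ger0_norm ?sqr_ge0//.
  by rewrite sqPP ltry.
have iprod l l' : P.-integrable setT (fun w => (pi l w * pi l' w)%:E) /\
    (\int[P]_w (pi l w * pi l' w)%:E =
     (if l == l' then (if (l : nat) is 0%N then v0 else v2) else 0)%:E)%E.
  have [->|ll'] := eqVneq l l'.
    split; first exact: (integrable_preserving (mpi l') (marg l') (isq l')).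
    by rewrite (integral_preserving (mpi l') (marg l') (isq l')).
  (* A mixed moment is written as a product over all indices, with 1 at the others, to fit the
     product rule. *)
  pose f m w := if (m == l) || (m == l') then pi m w else 1.
  have fE w : pi l w * pi l' w = \prod_m f m w.
    rewrite (bigD1 l)//= (bigD1 l')/=; last by rewrite eq_sym.
    rewrite big1 => [|m /andP[/negbTE ml /negbTE ml']].
      by rewrite /f !eqxx orbT mulr1.
    by rewrite /f ml ml'.
  have indf : indep_rv P f.
    have := indep_rv_comp
      (h := fun m (x : R) => if (m == l) || (m == l') then x else 1) _ ind.
    apply => m; case: (_ || _); [exact: measurable_id|exact: measurable_cst].
  have intf m : P.-integrable setT (EFin \o f m).
    rewrite /f; case: (_ || _); first exact: ipi.
    exact: finite_measure_integrable_cst.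
  under eq_fun do rewrite fE.
  split; first exact: integrable_prod_indep.
  rewrite integral_prod_indep// (bigD1 l)//=.
  rewrite [X in (X * _)%E](_ : _ = 0%E) ?mul0e//.
  by rewrite /f eqxx/= Epi.
have vE (l : 'I_n.+1) : k l ^+ 2 * (if (l : nat) is 0%N then v0 else v2) = vv l.
  rewrite /vv /k; case: (unliftP ord0 l) => [j ->|->] //=.
  rewrite sqr_sqrtr ?divfK ?gt_eqF// divr_ge0// ltW//.
exists d, Om, P, (fun l w => k l * pi l w), vv; split.
- split => l; last first.
    rewrite /vv; case: ifP => _; first exact: ltW.
    by apply: mulr_ge0; [apply: exprn_ge0|exact: ltW].
  split.
    apply: (@eq_integrable _ _ _ _ _ measurableT
      (fun w => (k l)%:E * (pi l w)%:E)%E); first by move=> w _; rewrite -EFinM.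
    by apply: integrableZl => //; exact: ipi.
  by under eq_integral do rewrite EFinM; rewrite integralZl ?Epi ?mule0//; exact: ipi.
- by [].
- move=> l l'; have [ill' _] := iprod l l'.
  apply: (@eq_integrable _ _ _ _ _ measurableT
    (fun w => (k l * k l')%:E * (pi l w * pi l' w)%:E)%E).
    by move=> w _; rewrite -EFinM; congr EFin; ring.
  exact: integrableZl.
- move=> l l'; have [ill' Ell'] := iprod l l'.
  transitivity (\int[P]_w ((k l * k l')%:E * (pi l w * pi l' w)%:E))%E.
    by apply: eq_integral => w _; rewrite -EFinM; congr EFin; ring.
  rewrite integralZl// Ell' -EFinM; congr EFin.
  by case: eqVneq => [<-|_]; [rewrite -vE|rewrite mulr0].
- move=> s s0 sl.
  have [|||S [mS piS SP]] := Spi (fun l x => x + s l / k l)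
      (fun l => if (l : nat) is 0%N then expR eps' else expR eps2).
  + by move=> l; exact: measurable_shift.
  + by move=> [[|l] ?]; rewrite expR_ge0.
  + move=> l; rewrite /PP.
    have : `|s l / k l| <= 1.
      rewrite normrM normfV (gtr0_norm (kp l)) ler_pdivrMr// mul1r /k.
      by case: eqP => [->|_] //; rewrite (le_trans s0).
    by case: l => -[|l] /= ? h C mC; [apply: dp0|apply: dp2].
  exists S; split => //.
    move=> l w; rewrite piS mulrDr mulrCA mulfV ?mulr1// gt_eqF//.
  move=> C mC; apply: (le_trans (SP C mC)).
  (* The total exponent is [eps' + n * (eps - eps') / n.+1], at most [eps]. *)
  rewrite lee_wpmul2r// lee_fin big_ord_recl/= prodr_const card_ord.
  rewrite -expRM_natl -expRD ler_expR /eps2.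
  rewrite -lerBrDl mulrCA ger_pMr ?subr_gt0//.
  by rewrite ler_pdivrMr// mul1r ler_nat.
Qed.

(** * Linear map from the underlying noises to the nodes *)

Section node_noise.
Context (R : realType) (n : nat).
Implicit Types (j : 'I_n.+2) (l : 'I_n) (del : R).

(* Rows of the layer of masking noises: node 0 gets none, node l.+1 gets the
   l-th one, and the last node gets minus their sum. *)
Definition node_mask j l : R :=
  if j == ord0 then 0 else if j == ord_max then -1 else (j == l.+1 :> nat)%:R.

Definition node_scale del j : R := if j == ord0 then 1 else 1 + del.

(** Matrix from underlying noises to node noises: column [ord0] belongs to the main noise, column
    [lift ord0 l] to the mask [l]. *)
Definition node_coef del j (l : 'I_n.+1) : R :=
  if unlift ord0 l is Some l' then del * node_mask j l' else node_scale del j.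

Lemma node_coef_sum del j (f : 'I_n.+1 -> R) :
  \sum_l node_coef del j l * f l =
  node_scale del j * f ord0 + del * \sum_l node_mask j l * f (lift ord0 l).
Proof.
rewrite big_ord_recl /node_coef unlift_none; congr (_ + _).
by rewrite mulr_sumr; apply: eq_bigr => l _; rewrite liftK mulrA.
Qed.

Lemma node_mask_sum l : \sum_j node_mask j l = 0.
Proof.
have lmax : lift ord0 (widen_ord (leqnSn n) l) != ord_max :> 'I_n.+2.
  by rewrite -val_eqE/= /bump/= add1n eqSS ltn_eqF.
rewrite (bigD1 ord_max)//= (bigD1 (lift ord0 (widen_ord (leqnSn n) l)))//=.
rewrite big1 => [|j /andP[jmax jl]].
  by rewrite /node_mask /= (negbTE lmax) eqxx/= /bump/= add1n eqxx addr0 addNr.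
rewrite /node_mask (negbTE jmax); case: ifP => // _.
move: jl; rewrite -val_eqE/= /bump/= add1n => /negbTE.
by rewrite /nat_of_ord/= => ->.
Qed.

(** For masks of variances [v] this is the second moment of their sum over all nodes, and that sum
    is identically zero. *)
Lemma node_mask_sum_sqr (v : 'I_n -> R) :
  \sum_j \sum_j' \sum_l node_mask j l * node_mask j' l * v l = 0.
Proof.
rewrite big1// => j _; rewrite exchange_big big1//= => l _.
under eq_bigr do rewrite -mulrA mulrCA.
by rewrite -mulr_suml node_mask_sum mul0r.
Qed.

(* Any n.+1 nodes miss some node j; shifting the underlying noises by [s]
   shifts all the nodes but j by [a]. *)
Lemma node_coef_shift del (j : 'I_n.+2) (a : R) : 0 < del -> `|a| <= 1 ->
  exists s : 'I_n.+1 -> R, [/\ `|s ord0| <= 1, forall l : 'I_n.+1, `|s l| <= n.+1%:R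
    & forall j', j' != j -> \sum_l node_coef del j' l * s l = a].
Proof.
move=> d0 a1; have d1 : 0 < 1 + del by rewrite addr_gt0.
have [->|j0] := eqVneq j ord0.
  (* Without node 0, all nodes carry the main noise with factor [1 + del], so moving it alone
     suffices. *)
  pose s (l : 'I_n.+1) := if l == ord0 then a / (1 + del) else 0.
  have s1 (l : 'I_n.+1) : `|s l| <= 1.
    rewrite /s; case: ifP => _; last by rewrite normr0.
    rewrite normrM normfV (gtr0_norm d1) ler_pdivrMr// mul1r.
    by rewrite (le_trans a1)// lerDl ltW.
  exists s; split => // [l|j' j'0]; first by rewrite (le_trans (s1 l))// ler1n.
  rewrite node_coef_sum /s eqxx /node_scale (negbTE j'0) big1 ?mulr0 ?addr0.
    by rewrite mulrCA mulfV ?mulr1// gt_eqF.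
  by move=> l _; rewrite mulr0.
(* Node 0 forces the main noise to move by [a], so at every other observed node the mask must move
   by [- a] to cancel [del * a]. The last node sees minus the sum of the masks; the extra [n.+1 * a]
   on the mask of the missed node corrects that sum. If the last node is the missed one, no index
   meets the test. *)
pose s (l : 'I_n.+1) := if l == ord0 then a else
  - a + (if l == j :> nat then n.+1%:R * a else 0).
exists s; split.
- by rewrite /s eqxx.
- move=> l; rewrite /s; case: ifP => _; first by rewrite (le_trans a1)// ler1n.
  case: ifP => _; last by rewrite addr0 normrN (le_trans a1)// ler1n.
  rewrite -natr1 (_ : - a + _ = n%:R * a); last by ring.
  rewrite normrM normr_nat (le_trans (ler_wpM2l _ a1))// mulr1 lerDl//.
- move=> j' j'j; rewrite node_coef_sum {1}/s eqxx /node_scale.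
  have [->|j'0] := eqVneq j' ord0.
    by rewrite big1 ?mulr0 ?addr0 ?mul1r// => l _; rewrite /node_mask eqxx mul0r.
  suff -> : \sum_l node_mask j' l * s (lift ord0 l) = - a by ring.
  have sE l : s (lift ord0 l) = - a + (if l.+1 == j :> nat then n.+1%:R * a else 0).
    by rewrite /s /= /bump/= add1n.
  have := ltn_ord j; have := ltn_ord j'; move: j0 j'0 j'j => + + +.
  rewrite /node_mask -!val_eqE/= => j0 j'0 j'j jlt j'lt.
  rewrite (negbTE j'0); have [j'm|j'm] := eqVneq (j' : nat) n.+1.
    have jn : (j.-1 < n)%N by lia.
    rewrite -mulr_sumr; under eq_bigr do rewrite sE.
    rewrite big_split/= sumr_const card_ord -big_mkcond/=.
    rewrite (big_pred1 (Ordinal jn)) => [|l]; last by rewrite /= -val_eqE/=; lia.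
    by rewrite mulNrn -mulr_natl -natr1; ring.
  have jn : (j'.-1 < n)%N by lia.
  rewrite (bigD1 (Ordinal jn))//= big1 => [|l].
    rewrite sE/= prednK ?lt0n// eqxx mul1r addr0.
    by rewrite (negbTE j'j) addr0.
  rewrite -val_eqE/= => ll; rewrite (_ : (_ == _) = false) ?mul0r//; lia.
Qed.

End node_noise.

Lemma injective_ord_missed (n : nat) (t : 'I_n.+1 -> 'I_n.+2) : injective t ->
  exists j, forall k, t k != j.
Proof.
move=> inj_t; have /subsetPn[j _ jt] : ~~ ([set: 'I_n.+2]%SET \subset codom t).
  apply/negP => /subset_leq_card; rewrite cardsT card_codom// !card_ord.
  by rewrite ltnn.
by exists j => k; apply: contraNneq jt => <-; exact: codom_f.
Qed.

(** The variances [v] are fixed before [del], so that [del] can later tend to 0 with [v]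
    unchanged. *)
Lemma node_noise_vector (R : realType) (n : nat) (eps : R) : 0 < eps ->
  exists v : 'I_n.+1 -> R, [/\ forall l, 0 <= v l, v ord0 = sigma_star_sq eps
    & forall del, 0 < del ->
      exists d (Om : measurableType d) (P : probability Om R)
             (Z : 'I_n.+2 -> Om -> R),
      [/\ forall j, zero_mean P (Z j),
          forall j j', P.-integrable setT (fun w => (Z j w * Z j' w)%:E),
          forall j j', (\int[P]_w (Z j w * Z j' w)%:E =
            (\sum_l node_coef del j l * node_coef del j' l * v l)%:E)%E
        & forall a0 a1, `|a0 - a1| <= 1 -> forall t : 'I_n.+1 -> 'I_n.+2,
          injective t -> forall B : set (n.+1.-tuple R), measurable B ->
          (P [set w | B [tuple (a0 + Z (t k) w)%R | k < n.+1]] <=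
           (expR eps)%:E * P [set w | B [tuple (a1 + Z (t k) w)%R | k < n.+1]])%E]].
Proof.
move=> eps0; have [d [Om [P [X [v [[mX v0] vE iX EX SX]]]]]] := base_noise n eps0.
exists v; split => // del del0.
have iXl l : P.-integrable setT (EFin \o X l) by exact: (mX l).1.
pose Z j w := \sum_l node_coef del j l * X l w.
have mXl l : measurable_fun setT (X l).
  by apply/measurable_EFinP; exact: measurable_int (iXl l).
have mZ j : measurable_fun setT (Z j).
  by apply: measurable_sum => l; apply: measurable_funM.
have ZE j w : ((Z j w)%:E = \sum_l (node_coef del j l)%:E * (X l w)%:E)%E.
  by rewrite /Z -sumEFin; apply: eq_bigr => l _; rewrite EFinM.
have ZZE j j' w : ((Z j w * Z j' w)%:E = \sum_l \sum_l'
    (node_coef del j l * node_coef del j' l')%:E * (X l w * X l' w)%:E)%E.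
  rewrite /Z mulr_suml -sumEFin; apply: eq_bigr => l _.
  rewrite mulr_sumr -sumEFin; apply: eq_bigr => l' _.
  by rewrite -EFinM; congr EFin; ring.
have iXX l l' c : P.-integrable setT (fun w => c%:E * (X l w * X l' w)%:E)%E.
  exact: integrableZl.
exists d, Om, P, Z; split.
- move=> j; split.
    apply: (@eq_integrable _ _ _ _ _ measurableT
      (fun w => \sum_l (node_coef del j l)%:E * (X l w)%:E)%E).
      by move=> w _; rewrite /= ZE.
    by apply: integrable_sum => // l _; apply: integrableZl => //; exact: iXl.
  under eq_integral do rewrite ZE.
  rewrite integral_sum//; last first.
    by move=> l; apply: integrableZl => //; exact: iXl.
  rewrite big1// => l _; rewrite integralZl//; last exact: iXl.
  by rewrite (mX l).2 mule0.
- move=> j j'; under eq_fun do rewrite ZZE.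
  by apply: integrable_sum => // l _; apply: integrable_sum => // l' _.
- move=> j j'; under eq_integral do rewrite ZZE.
  rewrite integral_sum//; last by move=> l; apply: integrable_sum.
  rewrite -sumEFin; apply: eq_bigr => l _.
  rewrite integral_sum// (bigD1 l)//= big1 ?adde0 => [|l' ll'].
    by rewrite integralZl// EX eqxx -EFinM.
  by rewrite integralZl// EX eq_sym (negbTE ll') mule0.
- move=> a0 a1 a01 t inj_t B mB.
  (* The observed nodes miss some [j], so a shift [s] of the underlying noises moves all of them by
     [a0 - a1], and the event for [a0] is the [S]-preimage of the event for [a1]. *)
  have [j tj] := injective_ord_missed inj_t.
  have [s [s0 sl sE]] := node_coef_shift j del0 a01.
  have [S [mS XS SP]] := SX s s0 sl.
  have mC : measurable [set w | B [tuple (a1 + Z (t k) w)%R | k < n.+1]].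
    have := @measurable_fun_tnthP _ _ Om R n.+1
      (fun w => [tuple (a1 + Z (t k) w)%R | k < n.+1]).
    move=> [_ H]; rewrite -[X in measurable X]setTI; apply: H => // k.
    apply: (eq_measurable_fun (fun w => a1 + Z (t k) w)).
      by move=> w _; rewrite /= tnth_mktuple.
    exact: measurable_funD.
  apply: le_trans (SP _ mC).
  rewrite [X in (P X <= _)%E](_ : _ =
    S @^-1` [set w | B [tuple (a1 + Z (t k) w)%R | k < n.+1]])//.
  apply/funext => w /=; congr B; apply: eq_from_tnth => k; rewrite !tnth_mktuple.
  rewrite /Z; under [in RHS]eq_bigr do rewrite XS mulrDr.
  by rewrite big_split/= sE//; ring.
Qed.

(** * Mean square error *)

Section gram_forms.
Context (R : realDomainType) (J L : finType) (c : J -> L -> R) (v : L -> R).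
Hypothesis v0 : forall l, 0 <= v l.

(** Covariance of the combinations with coefficients [c j] and [c j'] of uncorrelated noises of
    variances [v]. *)
Definition gram j j' := \sum_l c j l * c j' l * v l.

(** Second moment of the [D]-weighted sum of the node products when input [i] has second moment
    [a i]. *)
Definition gram_form (n : nat) (D : J -> R) (a : 'I_n -> R) :=
  \sum_j \sum_j' D j * D j' * \prod_(i < n) (a i + gram j j').

(** Expanding one factor, with its Gram entry written as a sum over [l], leaves forms of the same
    kind with one factor fewer and weights [D j * c j l]. Nonnegativity and monotonicity in [a]
    follow by induction, the form without factors being a square. *)
Lemma gram_formS n (D : J -> R) (a : 'I_n.+1 -> R) :
  gram_form D a = a ord0 * gram_form D (fun i => a (lift ord0 i)) +
    \sum_l v l * gram_form (fun j => D j * c j l) (fun i => a (lift ord0 i)).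
Proof.
rewrite /gram_form mulr_sumr.
under [X in _ = _ + X]eq_bigr do rewrite mulr_sumr.
rewrite [X in _ = _ + X]exchange_big -big_split/=; apply: eq_bigr => j _.
rewrite mulr_sumr.
under [X in _ = _ + X]eq_bigr do rewrite mulr_sumr.
rewrite [X in _ = _ + X]exchange_big -big_split/=; apply: eq_bigr => j' _.
rewrite big_ord_recl.
set p := \prod_(i < n) _.
transitivity (a ord0 * (D j * D j' * p) + D j * D j' * p * gram j j'); first by ring.
by congr (_ + _); rewrite /gram mulr_sumr; apply: eq_bigr => l _; ring.
Qed.

Lemma gram_form_ge0 n (D : J -> R) (a : 'I_n -> R) :
  (forall i, 0 <= a i) -> 0 <= gram_form D a.
Proof.
elim: n D a => [|n IH] D a a0.
  rewrite /gram_form (_ : \sum_j _ = (\sum_j D j) ^+ 2) ?sqr_ge0//.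
  rewrite expr2 mulr_suml; apply: eq_bigr => j _; rewrite mulr_sumr.
  by apply: eq_bigr => j' _; rewrite big_ord0 mulr1.
rewrite gram_formS addr_ge0//; first by apply: mulr_ge0 => //; exact: IH.
by apply: sumr_ge0 => l _; apply: mulr_ge0 => //; exact: IH.
Qed.

Lemma gram_form_le n (D : J -> R) (a b : 'I_n -> R) :
  (forall i, 0 <= a i <= b i) -> gram_form D a <= gram_form D b.
Proof.
elim: n D a b => [|n IH] D a b ab.
  by apply: ler_sum => j _; apply: ler_sum => j' _; rewrite !big_ord0.
have a0 i : 0 <= a i by have /andP[] := ab i.
have b0 i : 0 <= b i by have /andP[/le_trans] := ab i; apply.
rewrite !gram_formS lerD//.
  apply: ler_pM => //; [exact: gram_form_ge0|by have /andP[] := ab ord0|exact: IH].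
by apply: ler_sum => l _; apply: ler_wpM2l => //; exact: IH.
Qed.

End gram_forms.

(** * Independent copies of the noise vector, one for each input *)

Section input_copies.
Context (R : realType) d1 (Om1 : measurableType d1) (P1 : probability Om1 R).
Context (N L : nat) (Z : 'I_N -> Om1 -> R) (c : 'I_N -> 'I_L -> R) (v : 'I_L -> R).
Hypothesis v0 : forall l, 0 <= v l.
Hypothesis mZ : forall j, zero_mean P1 (Z j).
Hypothesis iZ : forall j j', P1.-integrable setT (fun w => (Z j w * Z j' w)%:E).
Hypothesis EZ : forall j j', (\int[P1]_w (Z j w * Z j' w)%:E = (gram c v j j')%:E)%E.

(* The target product is treated as the output of an additional noiseless
   node, with decoding coefficient -1. *)
Let Z' (o : 'I_N.+1) w := if unlift ord0 o is Some j then Z j w else 0.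
Definition ext_coef (o : 'I_N.+1) l := if unlift ord0 o is Some j then c j l else 0.
Definition ext_dec (dec : 'I_N -> R) (o : 'I_N.+1) :=
  if unlift ord0 o is Some j then dec j else -1.

Let mean_Z' o : zero_mean P1 (Z' o).
Proof.
rewrite /Z'; case: (unlift ord0 o) => [j|]; first exact: mZ.
by split; [exact: integrable0|exact: integral0].
Qed.

Let cov_Z' o o' : P1.-integrable setT (fun w => (Z' o w * Z' o' w)%:E) /\
  (\int[P1]_w (Z' o w * Z' o' w)%:E = (gram ext_coef v o o')%:E)%E.
Proof.
rewrite /Z' /gram /ext_coef.
case: (unlift ord0 o) (unlift ord0 o') => [j|] [j'|] //.
- under eq_fun do rewrite mulr0.
  rewrite big1 => [|l _]; last by rewrite mulr0 mul0r.
  by split; [exact: integrable0|exact: integral0].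
- under eq_fun do rewrite mul0r.
  rewrite big1 => [|l _]; last by rewrite !mul0r.
  by split; [exact: integrable0|exact: integral0].
- under eq_fun do rewrite mul0r.
  rewrite big1 => [|l _]; last by rewrite !mul0r.
  by split; [exact: integrable0|exact: integral0].
Qed.

Let prod_Z' (a : R) o o' :
  P1.-integrable setT (fun w => ((a + Z' o w) * (a + Z' o' w))%:E) /\
  (\int[P1]_w ((a + Z' o w) * (a + Z' o' w))%:E =
   (a ^+ 2 + gram ext_coef v o o')%:E)%E.
Proof.
have E w : (((a + Z' o w) * (a + Z' o' w))%:E =
    (a ^+ 2)%:E + a%:E * (Z' o w)%:E + a%:E * (Z' o' w)%:E + (Z' o w * Z' o' w)%:E)%E.
  by rewrite -!EFinM -!EFinD; congr EFin; ring.
have [ioo Eoo] := cov_Z' o o'.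
have [io Eo] := mean_Z' o; have [io' Eo'] := mean_Z' o'.
have i1 : P1.-integrable setT (fun=> (a ^+ 2)%:E).
  exact: finite_measure_integrable_cst.
have i2 : P1.-integrable setT (fun w => a%:E * (Z' o w)%:E)%E by exact: integrableZl.
have i3 : P1.-integrable setT (fun w => a%:E * (Z' o' w)%:E)%E by exact: integrableZl.
have i12 := integrableD measurableT i1 i2.
have i123 := integrableD measurableT i12 i3.
under eq_fun do rewrite E.
split; first exact: integrableD.
rewrite integralD//= integralD//= integralD//= integral_cst//=.
rewrite !integralZl// Eo Eo' Eoo !mule0 !adde0.
by rewrite [X in (_ * X)%E](_ : _ = 1%E) ?mule1//; exact: probability_setT.
Qed.

Section copies.
Context d (Om : measurableType d) (P : probability Om R) (M : nat).
Context (pi : 'I_M -> Om -> Om1).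
Hypothesis mpi : forall i, measurable_fun setT (pi i).
Hypothesis Ppi : forall F : 'I_M -> set Om1, (forall i, measurable (F i)) ->
  P (\bigcap_i (pi i @^-1` F i)) = (\prod_i P1 (F i))%E.

Let Rn i j w := Z j (pi i w).

Let mZj j : measurable_fun setT (Z j).
Proof. by apply/measurable_EFinP; exact: measurable_int (mZ j).1. Qed.

Let mRn i j : measurable_fun setT (Rn i j).
Proof. exact: measurableT_comp (mZj j) (mpi i). Qed.

Let marg i B : measurable B -> P (pi i @^-1` B) = P1 B.
Proof. exact: (@product_marginal _ _ _ _ _ _ _ (fun=> P1) _ Ppi i B). Qed.

Lemma coding_scheme_copies : coding_scheme P Rn.
Proof.
split => //; split => [i j|E HE].
  have [iZj EZj] := mZ j.
  split; first exact: (integrable_preserving (mpi i) (@marg i) iZj).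
  by rewrite (integral_preserving (mpi i) (@marg i) iZj).
(* The preimages of measurable sets under [pi i] form a sigma-algebra containing the generators of
   family [i]. *)
have H i : exists F, measurable F /\ E i = pi i @^-1` F.
  have : preimage_set_system setT (pi i) measurable (E i).
    apply: (smallest_sub _ _ (HE i)).
      exact/sigma_algebra_preimage/sigma_algebra_measurable.
    move=> _ [j [B [mB ->]]]; exists (Z j @^-1` B); last by rewrite setTI.
    by rewrite -[X in measurable X]setTI; exact: mZj.
  by move=> [F mF <-]; exists F; rewrite setTI.
have [F HF] := choice H.
rewrite (_ : \bigcap_i E i = \bigcap_i (pi i @^-1` F i)); last first.
  by apply: eq_bigcapr => i _; exact: (HF i).2.
rewrite Ppi; last by move=> i; exact: (HF i).1.
by apply: eq_bigr => i _; rewrite (HF i).2 marg//; exact: (HF i).1.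
Qed.

Lemma node_DP_copies T (eps : R) :
  (forall a0 a1, `|a0 - a1| <= 1 -> forall t : 'I_T -> 'I_N, injective t ->
    forall B : set (T.-tuple R), measurable B ->
    (P1 [set w | B [tuple (a0 + Z (t k) w)%R | k < T]] <=
     (expR eps)%:E * P1 [set w | B [tuple (a1 + Z (t k) w)%R | k < T]])%E) ->
  node_DP P T Rn eps.
Proof.
move=> H i a0 a1 a01 t inj_t B mB.
have mC a : measurable [set w | B [tuple (a + Z (t k) w)%R | k < T]].
  have := @measurable_fun_tnthP _ _ Om1 R T
    (fun w => [tuple (a + Z (t k) w)%R | k < T]).
  move=> [_ K]; rewrite -[X in measurable X]setTI; apply: K => // k.
  apply: (eq_measurable_fun (fun w => a + Z (t k) w)).
    by move=> w _; rewrite /= tnth_mktuple.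
  exact: measurable_funD.
by have := H _ _ a01 _ inj_t _ mB; rewrite -!(@marg i)//.
Qed.

Let indep_copies (h : 'I_M -> Om1 -> R) : (forall i, measurable_fun setT (h i)) ->
  indep_rv P (fun i w => h i (pi i w)).
Proof.
move=> mh B mB; have mhB i : measurable (h i @^-1` B i).
  by rewrite -[X in measurable X]setTI; exact: mh.
rewrite (Ppi (F := fun i => h i @^-1` B i))//.
by apply: eq_bigr => i _; rewrite -(@marg i).
Qed.

(** The square is expanded over pairs of nodes, the noise is integrated first at fixed inputs, then
    the inputs; independence factors both integrals. The error is exactly the form at the second
    moments of the inputs, and monotonicity replaces these by [eta]. *)
Lemma LMSE_copies (eta : R) (dec : 'I_N -> R) :
  (LMSE P eta Rn dec <=
   (gram_form ext_coef v (ext_dec dec) (fun _ : 'I_M => eta))%:E)%E.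
Proof.
apply: ge_ereal_sup => _ [dA [OmA [Q [A [mA indA meanA varA ->]]]]].
pose C := gram ext_coef v; pose D := ext_dec dec.
have iA2 i : Q.-integrable setT (fun x => ((A i x) ^+ 2)%:E).
  apply/integrableP; split; first by apply/measurable_EFinP; exact: measurable_funX.
  under eq_integral do rewrite /= ger0_norm ?sqr_ge0//.
  by rewrite (le_lt_trans (varA i))// ltry.
pose a i := fine (\int[Q]_x ((A i x) ^+ 2)%:E)%E.
have aE i : (\int[Q]_x ((A i x) ^+ 2)%:E = (a i)%:E)%E.
  by rewrite fineK//; exact: (integrable_fin_num measurableT (iA2 i)).
have a0 i : 0 <= a i <= eta.
  rewrite -!lee_fin -aE varA andbT.
  by apply: integral_ge0 => x _; rewrite lee_fin sqr_ge0.
apply: (@le_trans _ _ (gram_form ext_coef v D a)%:E); last first.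
  by rewrite lee_fin; exact: gram_form_le.
rewrite le_eqVlt; apply/orP; left; apply/eqP.
have sumE (x : OmA) (w : Om) : (\sum_(j < N) dec j * \prod_(i < M) (A i x + Rn i j w)
    - \prod_(i < M) A i x) ^+ 2 =
    \sum_o \sum_o' D o * D o' *
      \prod_(i < M) ((A i x + Z' o (pi i w)) * (A i x + Z' o' (pi i w))).
  transitivity ((\sum_o D o * \prod_(i < M) (A i x + Z' o (pi i w))) ^+ 2).
    congr (_ ^+ 2); rewrite big_ord_recl /D /ext_dec /Z' unlift_none mulN1r [RHS]addrC.
    congr (_ - _); last by apply: eq_bigr => i _; rewrite addr0.
    by apply: eq_bigr => j _; rewrite liftK.
  rewrite expr2 mulr_suml; apply: eq_bigr => o _; rewrite mulr_sumr.
  by apply: eq_bigr => o' _; rewrite big_split/=; ring.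
have mZ' o : measurable_fun setT (Z' o).
  by apply/measurable_EFinP; exact: measurable_int (mean_Z' o).1.
rewrite fubini_tonelli1/=; last 2 first.
- apply/measurable_EFinP; apply: measurable_funX; apply: measurable_funB.
    apply: measurable_sum => j; apply: measurable_funM => //.
    apply: measurable_prod => i _; apply: measurable_funD.
      exact: measurableT_comp.
    exact: (measurableT_comp (mRn i j)).
  by apply: measurable_prod => i _; exact: measurableT_comp.
- by move=> z; rewrite lee_fin sqr_ge0.
have inner x : fubini_F P (fun z : OmA * Om => ((\sum_(j < N) dec j *
      \prod_(i < M) (A i z.1 + Rn i j z.2) - \prod_(i < M) A i z.1) ^+ 2)%:E) x =
    (\sum_o \sum_o' (D o * D o')%:E * (\prod_(i < M) ((A i x) ^+ 2 + C o o'))%:E)%E.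
  rewrite /fubini_F/=.
  have ip o o' i : P.-integrable setT
      (EFin \o (fun w => (A i x + Z' o (pi i w)) * (A i x + Z' o' (pi i w)))).
    exact: (integrable_preserving (mpi i) (@marg i) (prod_Z' (A i x) o o').1).
  have ind o o' : indep_rv P
      (fun i w => (A i x + Z' o (pi i w)) * (A i x + Z' o' (pi i w))).
    apply: (@indep_copies (fun i y => (A i x + Z' o y) * (A i x + Z' o' y))) => i.
    by apply: measurable_funM; apply: measurable_funD.
  have ipr o o' : P.-integrable setT (fun w => (D o * D o')%:E *
      (\prod_(i < M) ((A i x + Z' o (pi i w)) * (A i x + Z' o' (pi i w))))%:E)%E.
    by apply: integrableZl => //; apply: integrable_prod_indep.
  transitivity (\int[P]_w \sum_o \sum_o' (D o * D o')%:E *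
      (\prod_(i < M) ((A i x + Z' o (pi i w)) * (A i x + Z' o' (pi i w))))%:E)%E.
    apply: eq_integral => w _; rewrite sumE -sumEFin; apply: eq_bigr => o _.
    by rewrite -sumEFin; apply: eq_bigr => o' _; rewrite EFinM.
  rewrite integral_sum//; last by move=> o; apply: integrable_sum.
  apply: eq_bigr => o _; rewrite integral_sum//; apply: eq_bigr => o' _.
  rewrite integralZl//; last exact: integrable_prod_indep.
  rewrite integral_prod_indep//; congr (_ * _)%E; rewrite -prode_EFin.
  apply: eq_bigr => i _.
  have [i1 E1] := prod_Z' (A i x) o o'.
  by rewrite (integral_preserving (mpi i) (@marg i) i1).
under eq_integral do rewrite inner.
have indA' : indep_rv Q A.
  move=> B mB; apply: indA => i; apply: sub_sigma_algebra.
  by exists tt, (B i).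
have iA o o' i : Q.-integrable setT (EFin \o (fun x => (A i x) ^+ 2 + C o o')).
  apply: (@eq_integrable _ _ _ _ _ measurableT
    (fun x => ((A i x) ^+ 2)%:E + (C o o')%:E)%E); first by [].
  by apply: integrableD => //; exact: finite_measure_integrable_cst.
have indC o o' : indep_rv Q (fun i x => (A i x) ^+ 2 + C o o').
  apply: (indep_rv_comp (h := fun=> fun y => y ^+ 2 + C o o')) => // i.
  by apply: measurable_funD => //; exact: measurable_funX.
have ipr o o' : Q.-integrable setT (fun x => (D o * D o')%:E *
    (\prod_(i < M) ((A i x) ^+ 2 + C o o'))%:E)%E.
  by apply: integrableZl => //; apply: integrable_prod_indep.
rewrite integral_sum//; last by move=> o; apply: integrable_sum.
rewrite /gram_form -sumEFin; apply: eq_bigr => o _.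
rewrite integral_sum// -sumEFin; apply: eq_bigr => o' _.
rewrite integralZl//; last exact: integrable_prod_indep.
rewrite integral_prod_indep// [RHS]EFinM; congr (_ * _)%E; rewrite -prode_EFin.
apply: eq_bigr => i _.
under eq_integral do rewrite EFinD.
rewrite integralD//=; last exact: finite_measure_integrable_cst.
rewrite aE integral_cst//= EFinD [X in (_ + _ * X)%E](_ : _ = 1%E) ?mule1//.
exact: probability_setT.
Qed.

End copies.

Lemma input_copies (M : nat) :
  exists d (Om : measurableType d) (P : probability Om R)
         (Rn : 'I_M -> 'I_N -> Om -> R),
  [/\ coding_scheme P Rn,
      forall T (eps : R),
        (forall a0 a1, `|a0 - a1| <= 1 -> forall t : 'I_T -> 'I_N, injective t ->
          forall B : set (T.-tuple R), measurable B ->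
          (P1 [set w | B [tuple (a0 + Z (t k) w)%R | k < T]] <=
           (expR eps)%:E * P1 [set w | B [tuple (a1 + Z (t k) w)%R | k < T]])%E) ->
        node_DP P T Rn eps
    & forall (eta : R) (dec : 'I_N -> R),
        (LMSE P eta Rn dec <=
         (gram_form ext_coef v (ext_dec dec) (fun _ : 'I_M => eta))%:E)%E].
Proof.
have [d [Om [P [pi [mpi Ppi _]]]]] := product_space M (fun=> P1).
exists d, Om, P, (fun i j w => Z j (pi i w)); split.
- exact: coding_scheme_copies.
- by move=> T eps; exact: node_DP_copies.
- by move=> eta dec; exact: LMSE_copies.
Qed.

End input_copies.

(** * Mean square error for small [del] *)

Section lmse_limit.
Context (R : realType).

(** Second-order expansion with a remainder bounded on [|z| <= B]. Writing the coefficients as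
    quotients of [c ^+ M] avoids truncated exponents for small [M]. *)
Lemma expr_taylor3 (c B : R) (M : nat) : 0 < c -> 0 <= B ->
  exists (K : R) (rho : R -> R), 0 <= K /\ forall z, `|z| <= B ->
    `|rho z| <= K /\ (c + z) ^+ M = c ^+ M + M%:R * c ^+ M / c * z +
      M%:R * (M%:R - 1) / 2 * c ^+ M / c ^+ 2 * z ^+ 2 + z ^+ 3 * rho z.
Proof.
move=> c0 B0; have cn : c != 0 by rewrite gt_eqF.
elim: M => [|M [K [rho [K0 IH]]]].
  exists 0, (fun=> 0); split => // z _; rewrite normr0; split => //.
  by rewrite !expr0; field.
pose P2 := M%:R * (M%:R - 1) / 2 * c ^+ M / c ^+ 2.
exists (`|P2| + (c + B) * K), (fun z => P2 + (c + z) * rho z).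
split; first by rewrite addr_ge0// mulr_ge0// addr_ge0// ltW.
move=> z zB; have [rK E] := IH z zB; split.
  rewrite (le_trans (ler_normD _ _))// lerD2l normrM ler_pM//.
  by rewrite (le_trans (ler_normD _ _))// gtr0_norm// lerD2l.
rewrite exprS E [c ^+ M.+1]exprS -[M.+1%:R]natr1 /P2; move: (c ^+ M) (rho z) (M%:R) => x y m.
by field.
Qed.

Lemma sum2_affine (n : nat) (a b e f : R) (z g : 'I_n -> 'I_n -> R) :
  \sum_k \sum_k' (a + (b * z k k' + (e * z k k' ^+ 2 + f * g k k'))) =
  n%:R ^+ 2 * a + b * (\sum_k \sum_k' z k k') +
  e * (\sum_k \sum_k' z k k' ^+ 2) + f * (\sum_k \sum_k' g k k').
Proof.
under eq_bigr do rewrite !big_split/= -!mulr_sumr.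
rewrite !big_split/= -!mulr_sumr !sumr_const !card_ord -mulrnA -[a *+ _]mulr_natl.
by rewrite natrM; ring.
Qed.

(** The poles in [del] cancel. What remains is the second moment of [al V + be V'], with [E V V']
    and [E V' ^+ 2] written out, plus an error linear in [del] with a constant [K] independent of
    [del]. *)
Lemma lmse_limit (n M : nat) (eta sg al be : R) (zeta : 'I_n.+1 -> 'I_n.+1 -> R) :
  0 < eta -> 0 < sg -> \sum_k \sum_k' zeta k k' = 0 ->
  let c := eta + sg in
  exists K : R, forall del, 0 < del -> del <= 1 ->
    (al - be / del) ^+ 2 * c ^+ M +
    2 * (al - be / del) * (be / del) * (eta + (1 + del) * sg) ^+ M +
    \sum_k \sum_k' (be / (del * n.+1%:R)) ^+ 2 *
      (eta + ((1 + del) ^+ 2 * sg + del ^+ 2 * zeta k k')) ^+ M <=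
    al ^+ 2 * c ^+ M + 2 * al * be * (M%:R * c ^+ M / c * sg) +
    be ^+ 2 * (M%:R * c ^+ M / c * sg +
       M%:R * (M%:R - 1) * c ^+ M / c ^+ 2 * sg ^+ 2) + del * K.
Proof.
move=> eta0 sg0 z0 c; have c0 : 0 < c by rewrite addr_gt0.
pose Zm := \sum_k \sum_k' `|zeta k k'|.
have Zm0 : 0 <= Zm by apply: sumr_ge0 => k _; apply: sumr_ge0.
have zZ k k' : `|zeta k k'| <= Zm.
  rewrite /Zm (bigD1 k)//= (bigD1 k')//= -addrA lerDl addr_ge0//.
    exact: sumr_ge0.
  by apply: sumr_ge0 => ? _; exact: sumr_ge0.
pose B := 3 * sg + Zm.
have B0 : 0 <= B by rewrite addr_ge0// mulr_ge0// ltW.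
have [K [rho [K0 Hrho]]] := expr_taylor3 M c0 B0.
pose P0 := c ^+ M; pose P1 := M%:R * c ^+ M / c.
pose P2 := M%:R * (M%:R - 1) / 2 * c ^+ M / c ^+ 2.
pose T : R := n.+1%:R; have T0 : 0 < T by rewrite ltr0n.
pose Zs := \sum_k \sum_k' zeta k k' ^+ 2.
(* [bd1] and [bd2] gather the surplus quadratic Taylor terms of first and second order in [del]; the
   rest of [KK] bounds the cubic remainders. *)
pose bd1 := 2 * al * be * P2 * sg ^+ 2 + 4 * be ^+ 2 * P2 * sg ^+ 2.
pose bd2 := be ^+ 2 * P2 * (sg ^+ 2 + Zs / T ^+ 2).
pose KK := `|bd1| + `|bd2| + 2 * `|al * be| * (sg ^+ 3 * K) +
  2 * be ^+ 2 * (sg ^+ 3 * K) + be ^+ 2 * (B ^+ 3 * K).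
exists KK => del d0 d1.
have del0 : del != 0 by rewrite gt_eqF.
have dn : `|del| = del by rewrite gtr0_norm.
(* The increment over [c] is [u + del ^+ 2 * zeta k k'], that is, [del * y k k']. *)
pose u := sg * (2 * del + del ^+ 2).
pose y k k' := sg * (2 + del) + del * zeta k k'.
have yB k k' : `|y k k'| <= B.
  rewrite (le_trans (ler_normD _ _))// lerD// normrM.
    rewrite !ger0_norm ?addr_ge0 ?(ltW d0) ?(ltW sg0)//; nra.
  by rewrite -[leRHS]mul1r ler_pM// dn.
have zB k k' : `|del * y k k'| <= B.
  by rewrite normrM -[leRHS]mul1r ler_pM// dn.
have sB : `|del * sg| <= B.
  by rewrite normrM dn (gtr0_norm sg0) /B; nra.
have [r1K E1] := Hrho _ sB.
pose g k k' := y k k' ^+ 3 * rho (del * y k k').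
pose Y := \sum_k \sum_k' g k k'.
have YB : `|Y| <= T ^+ 2 * (B ^+ 3 * K).
  apply: (@le_trans _ _ (\sum_(k < n.+1) \sum_(k' < n.+1) B ^+ 3 * K)).
    rewrite (le_trans (ler_norm_sum _ _ _))// ler_sum// => k _.
    rewrite (le_trans (ler_norm_sum _ _ _))// ler_sum// => k' _.
    rewrite normrM normrX ler_pM ?exprn_ge0//; last exact: (Hrho _ (zB k k')).1.
    by rewrite ler_pXn2r ?nnegrE.
  by rewrite !sumr_const !card_ord -!mulrnA -mulr_natl natrM expr2.
(* The term linear in [zeta] would survive division by [del ^+ 2]; it drops out because [zeta] sums
   to zero. *)
have S2 : \sum_k \sum_k' (eta + ((1 + del) ^+ 2 * sg + del ^+ 2 * zeta k k')) ^+ M =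
    T ^+ 2 * (P0 + P1 * u + P2 * u ^+ 2) + del ^+ 4 * P2 * Zs + del ^+ 3 * Y.
  transitivity (\sum_k \sum_k' ((P0 + P1 * u + P2 * u ^+ 2) +
      ((del ^+ 2 * P1 + 2 * u * del ^+ 2 * P2) * zeta k k' +
       (del ^+ 4 * P2 * zeta k k' ^+ 2 + del ^+ 3 * g k k')))).
    apply: eq_bigr => k _; apply: eq_bigr => k' _.
    rewrite (_ : eta + _ = c + del * y k k'); last by rewrite /c /y; ring.
    rewrite (Hrho _ (zB k k')).2 -/P0 -/P1 -/P2 /g /u /y; ring.
  by rewrite sum2_affine z0 mulr0 addr0.
under eq_bigr do rewrite -mulr_sumr.
rewrite -mulr_sumr S2.
have -> : eta + (1 + del) * sg = c + del * sg by rewrite /c; ring.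
rewrite E1 -/P0 -/P1 -/P2.
set r1 := rho _ in r1K *.
have -> : M%:R * (M%:R - 1) * c ^+ M / c ^+ 2 = 2 * P2.
  by rewrite /P2; field; rewrite gt_eqF.
rewrite [leLHS](_ : _ = al ^+ 2 * P0 + 2 * al * be * (P1 * sg) +
    be ^+ 2 * (P1 * sg + 2 * P2 * sg ^+ 2) +
    del * (bd1 + del * bd2 + 2 * (al * be) * (del * sg ^+ 3 * r1)
       - 2 * be ^+ 2 * (sg ^+ 3 * r1) + be ^+ 2 * (Y / T ^+ 2))); last first.
  rewrite /bd1 /bd2 /u -/T.
  by field; rewrite del0 gt_eqF.
rewrite lerD2l ler_pM2l//.
have s3 : 0 <= sg ^+ 3 by rewrite exprn_ge0// ltW.
have r1b : `|sg ^+ 3 * r1| <= sg ^+ 3 * K by rewrite normrM ger0_norm// ler_wpM2l.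
have Yb : `|Y / T ^+ 2| <= B ^+ 3 * K.
  by rewrite normrM normfV [`|T ^+ 2|]ger0_norm ?sqr_ge0// ler_pdivrMr ?exprn_gt0// mulrC.
rewrite /KK; apply: lerD; last first.
  by rewrite ler_wpM2l ?sqr_ge0// (le_trans (ler_norm _)).
apply: lerD; last first.
  rewrite -mulrN; apply: ler_wpM2l.
    by apply: mulr_ge0 => //; exact: sqr_ge0.
  by apply: le_trans r1b; rewrite -normrN ler_norm.
apply: lerD; last first.
  have -> : 2 * (al * be) * (del * sg ^+ 3 * r1) =
      2 * ((al * be) * (del * (sg ^+ 3 * r1))) by ring.
  apply: le_trans (ler_norm _) _.
  rewrite -[leRHS]mulrA normrM normr_nat; apply: ler_wpM2l => //.
  rewrite normrM; apply: ler_wpM2l => //.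
  by rewrite normrM dn -[leRHS]mul1r; apply: ler_pM => //; exact: ltW.
apply: lerD; first exact: ler_norm.
by rewrite (le_trans (ler_norm _))// normrM -[leRHS]mul1r ler_pM// dn.
Qed.

End lmse_limit.

(** * Decoding weights, their optimal choice and the conclusion *)

Section node_decoder.
Context (R : realType) (n M : nat) (eta al be del : R) (v : 'I_n.+1 -> R).

(** The weights sum to [al]; the parts in [be] form a difference quotient of step [del] between node
    0 and the average of the [n.+1] others. *)
Definition node_dec (j : 'I_n.+2) : R :=
  if j == ord0 then al - be / del else be / (del * n.+1%:R).

Definition mask_cov (k k' : 'I_n.+1) : R := \sum_(l < n)
  node_mask R (lift ord0 k) l * node_mask R (lift ord0 k') l * v (lift ord0 l).

(** Node 0 has no mask, so restoring its row and column gives the vanishing sum over all nodes. *)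
Lemma mask_cov_sum : \sum_k \sum_k' mask_cov k k' = 0.
Proof.
apply: etrans (node_mask_sum_sqr (fun l => v (lift ord0 l))).
rewrite [RHS]big_ord_recl.
rewrite [X in _ = X + _]big1 ?add0r => [|j _]; last first.
  by rewrite big1// => l _; rewrite /node_mask eqxx !mul0r.
apply: eq_bigr => k _; rewrite [RHS]big_ord_recl.
rewrite [X in _ = X + _]big1 ?add0r// => l _.
have -> : node_mask R (ord0 : 'I_n.+2) l = 0 by rewrite /node_mask eqxx.
by rewrite mulr0 mul0r.
Qed.

Lemma gram_node j j' : gram (node_coef del) v j j' =
  node_scale del j * node_scale del j' * v ord0 + del ^+ 2 *
  \sum_(l < n) node_mask R j l * node_mask R j' l * v (lift ord0 l).
Proof.
rewrite /gram big_ord_recl /node_coef unlift_none; congr (_ + _).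
by rewrite mulr_sumr; apply: eq_bigr => l _; rewrite liftK; ring.
Qed.

(** The noiseless extra node has zero covariance with every node, so it contributes [eta ^+ M] and,
    the weights summing to [al], the cross term; the rest is split into node 0 and the other
    nodes. *)
Lemma gram_form_node_dec : 0 < del ->
  gram_form (ext_coef (node_coef del)) v (ext_dec node_dec) (fun _ : 'I_M => eta) =
  eta ^+ M - 2 * al * eta ^+ M +
  ((al - be / del) ^+ 2 * (eta + v ord0) ^+ M +
   2 * (al - be / del) * (be / del) * (eta + (1 + del) * v ord0) ^+ M +
   \sum_k \sum_k' (be / (del * n.+1%:R)) ^+ 2 *
     (eta + ((1 + del) ^+ 2 * v ord0 + del ^+ 2 * mask_cov k k')) ^+ M).
Proof.
move=> d0; have dn : del != 0 by rewrite gt_eqF.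
have Tn : (n.+1%:R : R) != 0 by rewrite pnatr_eq0.
have dec0 : node_dec ord0 = al - be / del by rewrite /node_dec eqxx.
have decS k : node_dec (lift ord0 k) = be / (del * n.+1%:R) by [].
have dec_sum : \sum_j node_dec j = al.
  rewrite big_ord_recl dec0; under eq_bigr do rewrite decS.
  rewrite sumr_const card_ord -[_ * _ *+ _]mulr_natl; move: Tn; move: (n.+1%:R : R) => T' Tn.
  by field; rewrite ?dn ?Tn.
have g0 o : gram (ext_coef (node_coef del)) v ord0 o = 0.
  by rewrite /gram big1// => l _; rewrite /ext_coef unlift_none !mul0r.
have g0' o : gram (ext_coef (node_coef del)) v o ord0 = 0.
  by rewrite /gram big1// => l _; rewrite /ext_coef unlift_none mulr0 mul0r.
have gS j j' : gram (ext_coef (node_coef del)) v (lift ord0 j) (lift ord0 j') =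
    gram (node_coef del) v j j'.
  by apply: eq_bigr => l _; rewrite /ext_coef !liftK.
have m0 l : node_mask R (ord0 : 'I_n.+2) l = 0 by rewrite /node_mask eqxx.
have n00 : gram (node_coef del) v ord0 ord0 = v ord0.
  rewrite gram_node big1 => [|l _]; last by rewrite m0 !mul0r.
  by rewrite /node_scale eqxx; ring.
have n0S k : gram (node_coef del) v ord0 (lift ord0 k) = (1 + del) * v ord0.
  rewrite gram_node big1 => [|l _]; last by rewrite m0 !mul0r.
  by rewrite /node_scale eqxx/=; ring.
have nS0 k : gram (node_coef del) v (lift ord0 k) ord0 = (1 + del) * v ord0.
  rewrite gram_node big1 => [|l _]; last by rewrite m0 mulr0 mul0r.
  by rewrite /node_scale eqxx/=; ring.
have nSS k k' : gram (node_coef del) v (lift ord0 k) (lift ord0 k') =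
    (1 + del) ^+ 2 * v ord0 + del ^+ 2 * mask_cov k k'.
  by rewrite gram_node /node_scale/= expr2.
rewrite /gram_form; under eq_bigr do under eq_bigr do rewrite prodr_const card_ord.
transitivity (eta ^+ M - 2 * al * eta ^+ M + \sum_j \sum_j'
    node_dec j * node_dec j' * (eta + gram (node_coef del) v j j') ^+ M).
  have e0 : ext_dec node_dec ord0 = -1 by rewrite /ext_dec unlift_none.
  have eS j : ext_dec node_dec (lift ord0 j) = node_dec j by rewrite /ext_dec liftK.
  rewrite [LHS]big_ord_recl [X in X + _ = _]big_ord_recl g0 e0.
  under [X in _ + X + _ = _]eq_bigr do rewrite g0 eS addr0.
  under [X in _ + _ + X = _]eq_bigr do rewrite big_ord_recl g0' e0 eS addr0.
  rewrite big_split/= addrA; congr (_ + _).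
    by rewrite -!mulr_suml -mulr_sumr dec_sum addr0; ring.
  by apply: eq_bigr => j _; apply: eq_bigr => j' _; rewrite gS eS.
congr (_ + _); rewrite [LHS]big_ord_recl [X in X + _ = _]big_ord_recl dec0 n00.
under [X in _ + X + _ = _]eq_bigr do rewrite n0S decS.
under [X in _ + _ + X = _]eq_bigr do rewrite big_ord_recl nS0 decS dec0.
rewrite big_split/= addrA; congr (_ + _).
  rewrite !sumr_const !card_ord -![_ * _ *+ _]mulr_natl; move: Tn.
  by move: (n.+1%:R : R) => T' Tn; field; rewrite ?dn ?Tn.
by apply: eq_bigr => k _; apply: eq_bigr => k' _; rewrite nSS decS expr2.
Qed.

End node_decoder.

(** With [K] binomial for [M] trials of probability [sg / c], the left side is [c ^+ M] times the
    mean of the square of [1_{K=0} - al - be K]. Here [be] is the covariance of [1_{K=0}] and [K]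
    over the variance of [K], and [al = q ^+ M - be E K]. *)
Lemma optimal_decoder_value (R : realType) (m : nat) (eta sg : R) :
  0 < eta -> 0 < sg ->
  let M := m.+1 in let c := eta + sg in let q := eta / c in let s := eta / sg in
  let be := - q ^+ m in let al := q ^+ m.+1 + M%:R * (sg / c) * q ^+ m in
  eta ^+ M - 2 * al * eta ^+ M + (al ^+ 2 * c ^+ M +
    2 * al * be * (M%:R * c ^+ M / c * sg) +
    be ^+ 2 * (M%:R * c ^+ M / c * sg +
       M%:R * (M%:R - 1) * c ^+ M / c ^+ 2 * sg ^+ 2)) =
  eta ^+ M * (((1 + s) ^+ M - M%:R * s ^+ m - s ^+ M) / (1 + s) ^+ M).
Proof.
move=> eta0 sg0 M c q s be al.
have c0 : 0 < c by rewrite addr_gt0.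
have s1 : 1 + s = c / sg by rewrite /s /c; field; rewrite gt_eqF.
rewrite s1 /al /be /q /s /M !expr_div_n !exprS.
have cm : c ^+ m != 0 by rewrite expf_neq0// gt_eqF.
have sm : sg ^+ m != 0 by rewrite expf_neq0// gt_eqF.
have cE : eta = c - sg by rewrite /c; ring.
move: cm sm; move: (c ^+ m) (sg ^+ m) (eta ^+ m) (m.+1%:R) => C S E k Cn Sn.
move: c0 cE; move: (c) => c' c0 ->.
field.
by rewrite Cn Sn !gt_eqF.
Qed.

Theorem theorem3 (R : realType) (N T M : nat) (eta : R) :
  (0 < N)%N -> (0 < T)%N -> (0 < M)%N -> N = T.+1 -> (N < M)%N -> 0 < eta ->
  forall eps xi : R, 0 < eps -> 0 < xi ->
  exists (d : measure_display) (Om : measurableType d) (P : probability Om R)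
         (Rn : 'I_M -> 'I_N -> Om -> R) (dec : 'I_N -> R),
    [/\ coding_scheme P Rn,
        node_DP P T Rn eps &
        (LMSE P eta Rn dec <=
          (eta ^+ M * (((1 + SNR_star eta eps) ^+ M
                        - M%:R * SNR_star eta eps ^+ M.-1
                        - SNR_star eta eps ^+ M)
                       / (1 + SNR_star eta eps) ^+ M) + xi)%:E)%E].
Proof.
move=> _; case: T => // n _; case: M => // m _ -> _ eta0 eps xi eps0 xi0.
have [v [v0 vE Hv]] := node_noise_vector n eps0.
have sg0 : 0 < sigma_star_sq eps.
  rewrite /sigma_star_sq divr_gt0//; last first.
    by rewrite exprn_gt0// subr_gt0 expR_lt1 oppr_lt0.
  by rewrite addr_gt0 ?expR_gt0// !mulr_gt0 ?powR_gt0 ?expR_gt0 ?addr_gt0 ?expR_gt0.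
set sg := sigma_star_sq eps in vE sg0.
pose q := eta / (eta + sg).
pose be := - q ^+ m; pose al := q ^+ m.+1 + m.+1%:R * (sg / (eta + sg)) * q ^+ m.
have [K HK] := lmse_limit m.+1 al be eta0 sg0 (mask_cov_sum v).
(* Small enough for [del * K <= xi] and for the expansion, which assumes [del <= 1]; the added 1
   keeps the denominator positive. *)
pose del := Num.min 1 (xi / (`|K| + 1)).
have K1 : 0 < `|K| + 1 by rewrite ltr_wpDl.
have del0 : 0 < del by rewrite /del lt_min ltr01 divr_gt0.
have del1 : del <= 1 by rewrite /del ge_min lexx.
have delK : del * K <= xi.
  apply: (@le_trans _ _ (del * (`|K| + 1))).
    by rewrite ler_pM2l// (le_trans (ler_norm _))// lerDl.
  by rewrite -ler_pdivlMr// /del ge_min lexx orbT.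
have [d1 [Om1 [P1 [Z [mZ iZ EZ DP]]]]] := Hv _ del0.
have [d [Om [P [Rn [cs dp lmse]]]]] := input_copies v0 mZ iZ EZ m.+1.
exists d, Om, P, Rn, (@node_dec R n al be del); split; first exact: cs.
  exact: dp.
apply: (le_trans (lmse eta _)); rewrite lee_fin gram_form_node_dec// vE.
have E := optimal_decoder_value m eta0 sg0.
rewrite /SNR_star -/sg -E -[leRHS]addrA lerD2l.
by apply: (le_trans (HK _ del0 del1)); rewrite lerD2l.
Qed.
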